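(* Let $M^{2n+1}(\varphi,\xi,\eta,g)$ be an $\eta$-Einstein Kenmotsu manifold of dimension $2n+1$ with $n>1$. Suppose that $g$ represents an $\eta$-Ricci soliton with potential vector field $V$, i.e. there are real constants $\lambda,\mu$ such that $$\tfrac12\,\mathcal{L}_V g+\mathrm{Ric}+\lambda\,g+\mu\,\eta\otimes\eta=0 .$$ Then $(M,g)$ is Einstein with constant scalar curvature $r=-2n(2n+1)$.
   Context: An almost contact structure on a smooth manifold $M^{2n+1}$ of dimension $2n+1$ is a triple $(\varphi,\xi,\eta)$, where $\varphi$ is a $(1,1)$-tensor, $\xi$ a vector field (the Reeb vector field) and $\eta$ a $1$-form with $\varphi^2=-I+\eta\otimes\xi$ and $\eta(\xi)=1$. A Riemannian metric $g$ is compatible if $g(\varphi X,\varphi Y)=g(X,Y)-\eta(X)\eta(Y)$ for all vector fields $X,Y$; then $M(\varphi,\xi,\eta,g)$ is an almost contact metric manifold. It is a Kenmotsu manifold if $(\nabla_X\varphi)Y=g(\varphi X,Y)\,\xi-\eta(Y)\,\varphi X$ for all vector fields $X,Y$, where $\nabla$ is the Levi-Civita connection of $g$. Such a manifold is $\eta$-Einstein if $\mathrm{Ric}=\alpha\,g+\beta\,\eta\otimes\eta$ for some smooth functions $\alpha,\beta$ on $M$. Here $\mathcal{L}_V$ is the Lie derivative along $V$, $\mathrm{Ric}$ the Ricci tensor, $r$ the scalar curvature of $g$, and $(\eta\otimes\eta)(X,Y)=\eta(X)\eta(Y)$. Einstein means that $\mathrm{Ric}$ is a constant multiple of $g$. 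*)

(* Defs.v *)
From mathcomp Require Import all_boot all_order all_algebra.
From mathcomp Require Import all_classical all_reals all_analysis.
From mathcomp Require Import ring.
Import Order.TTheory GRing.Theory Num.Theory.
Import numFieldNormedType.Exports.

Set Implicit Arguments.
Unset Strict Implicit.
Unset Printing Implicit Defensive.

Local Open Scope classical_set_scope.
Local Open Scope ring_scope.

(* Smoothness on an open set U: every iterated directional derivative exists
   and is differentiable on U. *)
Fixpoint Ck_on (R : realType) (V W : normedModType R) (k : nat)
    (U : set V) (f : V -> W) : Prop :=
  match k with
  | 0%N => forall x, U x -> {for x, continuous f}
  | k'.+1 => (forall x, U x -> differentiable f x) /\
             (forall v, Ck_on k' U (fun x => 'D_v f x))
  end.

Definition smooth_on (R : realType) (V W : normedModType R)
    (U : set V) (f : V -> W) : Prop :=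
  forall k, Ck_on k U f.

Record smooth_atlas (R : realType) (m : nat) (M : topologicalType) :=
  SmoothAtlas {
    chart : Type ;
    dom : chart -> set M ;
    img : chart -> set 'rV[R]_m ;
    coord : chart -> M -> 'rV[R]_m ;
    point : chart -> 'rV[R]_m -> M ;
    dom_open : forall a, open (dom a) ;
    img_open : forall a, open (img a) ;
    coord_img : forall a p, dom a p -> img a (coord a p) ;
    point_dom : forall a x, img a x -> dom a (point a x) ;
    coordK : forall a p, dom a p -> point a (coord a p) = p ;
    pointK : forall a x, img a x -> coord a (point a x) = x ;
    coord_continuous : forall a p, dom a p -> {for p, continuous (coord a)} ;
    point_continuous : forall a x, img a x -> {for x, continuous (point a)} ;
    dom_cover : forall p, exists a, dom a p ;
    transition_smooth : forall a b,
      smooth_on (img a `&` (point a @^-1` dom b)) (coord b \o point a)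
  }.

Section GlobalObjects.
Variables (R : realType) (m : nat) (M : topologicalType).
Variable A : smooth_atlas R m M.

Definition manifold : Prop := hausdorff_space M /\ @second_countable M.

Definition overlap (a b : chart A) : set 'rV[R]_m :=
  img a `&` (point a @^-1` dom b).

Definition transition (a b : chart A) : 'rV[R]_m -> 'rV[R]_m :=
  coord b \o point a.

(* The differential of the change of coordinates from a to b. *)
Definition dtrans (a b : chart A) (x v : 'rV[R]_m) : 'rV[R]_m :=
  'D_v (transition a b) x.

Definition smooth_fun (f : M -> R) : Prop :=
  forall a : chart A, smooth_on (img a) (f \o point a).

End GlobalObjects.

(* Tensors at a point, in coordinates. Tangent vectors are rows, so an
   endomorphism acts on the right; a covector is a column, a bilinear form is
   its Gram matrix. *)
Definition endo (R : realType) (m : nat) (F : 'M[R]_m) (v : 'rV[R]_m) :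
  'rV[R]_m := v *m F.

Definition covec (R : realType) (m : nat) (w : 'cV[R]_m) (v : 'rV[R]_m) : R :=
  (v *m w) 0 0.

Definition bilin (R : realType) (m : nat) (B : 'M[R]_m) (v w : 'rV[R]_m) : R :=
  (v *m B *m w^T) 0 0.

(* A tensor field on M is the family of its coordinate representatives, each
   one smooth on the image of its chart (and arbitrary outside), related to
   each other by the changes of coordinates. *)
Section TensorFields.
Variables (R : realType) (m : nat) (M : topologicalType).
Variable A : smooth_atlas R m M.

Definition vector_field (X : chart A -> 'rV[R]_m -> 'rV[R]_m) : Prop :=
  (forall a, smooth_on (img a) (X a)) /\
  (forall a b x, overlap a b x ->
     X b (transition a b x) = dtrans a b x (X a x)).

Definition one_form (w : chart A -> 'rV[R]_m -> 'cV[R]_m) : Prop :=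
  (forall a, smooth_on (img a) (w a)) /\
  (forall a b x v, overlap a b x ->
     covec (w a x) v = covec (w b (transition a b x)) (dtrans a b x v)).

Definition tensor11 (F : chart A -> 'rV[R]_m -> 'M[R]_m) : Prop :=
  (forall a, smooth_on (img a) (F a)) /\
  (forall a b x v, overlap a b x ->
     dtrans a b x (endo (F a x) v)
     = endo (F b (transition a b x)) (dtrans a b x v)).

Definition tensor02 (B : chart A -> 'rV[R]_m -> 'M[R]_m) : Prop :=
  (forall a, smooth_on (img a) (B a)) /\
  (forall a b x u v, overlap a b x ->
     bilin (B a x) u v
     = bilin (B b (transition a b x)) (dtrans a b x u) (dtrans a b x v)).

End TensorFields.

Definition inner_product (R : realType) (m : nat) (B : 'M[R]_m) : Prop :=
  (forall u v, bilin B u v = bilin B v u) /\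
  (forall v, v != 0 -> 0 < bilin B v v).

Definition riemannian_metric (R : realType) (m : nat) (M : topologicalType)
    (A : smooth_atlas R m M) (g : chart A -> 'rV[R]_m -> 'M[R]_m) : Prop :=
  tensor02 g /\ (forall a x, img a x -> inner_product (g a x)).

(* Riemannian geometry of a metric g on an open set of R^m. *)
Section LocalGeometry.
Variables (R : realType) (m : nat).
Local Notation vf := ('rV[R]_m -> 'rV[R]_m).
Implicit Types (g : 'rV[R]_m -> 'M[R]_m) (X Y Z V : vf).

Definition coord_vec (i : 'I_m) : 'rV[R]_m := delta_mx 0 i.

Definition coord_field (i : 'I_m) : vf := fun _ => coord_vec i.

Definition metric g X Y : 'rV[R]_m -> R := fun x => bilin (g x) (X x) (Y x).

Definition apply_field X (f : 'rV[R]_m -> R) : 'rV[R]_m -> R :=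
  fun x => 'D_(X x) f x.

Definition bracket X Y : vf := fun x => 'D_(X x) Y x - 'D_(Y x) X x.

(* Christoffel symbols of the first kind, contracted with u, v, w. *)
Definition christoffel1 g (x u v w : 'rV[R]_m) : R :=
  2^-1 * ('D_u (fun y => bilin (g y) v w) x
          + 'D_v (fun y => bilin (g y) u w) x
          - 'D_w (fun y => bilin (g y) u v) x).

(* Christoffel symbols of the second kind: the index w is raised by g. *)
Definition christoffel g (x u v : 'rV[R]_m) : 'rV[R]_m :=
  (\row_k christoffel1 g x u v (coord_vec k)) *m invmx (g x).

(* The Levi-Civita connection; see nabla_torsion_free and nabla_metric. *)
Definition nabla g X Y : vf :=
  fun x => 'D_(X x) Y x + christoffel g x (X x) (Y x).

Definition nabla_endo g (F : 'rV[R]_m -> 'M[R]_m) X Y : vf :=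
  fun x => nabla g X (fun y => endo (F y) (Y y)) x - endo (F x) (nabla g X Y x).

Definition curvature g X Y Z : vf :=
  fun x => nabla g X (nabla g Y Z) x - nabla g Y (nabla g X Z) x
           - nabla g (bracket X Y) Z x.

(* Ric(Y, Z) is the trace of X |-> R(X, Y)Z. *)
Definition ricci g Y Z : 'rV[R]_m -> R :=
  fun x => \sum_(i < m) (curvature g (coord_field i) Y Z x) 0 i.

Definition scalar_curvature g : 'rV[R]_m -> R :=
  fun x => \sum_(i < m) \sum_(j < m)
    invmx (g x) i j * ricci g (coord_field i) (coord_field j) x.

Definition lie_metric V g X Y : 'rV[R]_m -> R :=
  fun x => apply_field V (metric g X Y) x
           - metric g (bracket V X) Y x - metric g X (bracket V Y) x.

End LocalGeometry.

Section LeviCivita.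
Variables (R : realType) (m : nat).
Variables (U : set 'rV[R]_m) (g : 'rV[R]_m -> 'M[R]_m).
Hypothesis U_open : open U.
Hypothesis g_smooth : smooth_on U g.
Hypothesis g_inner : forall x, U x -> inner_product (g x).

Let bilinE (B : 'M[R]_m) (u v : 'rV[R]_m) :
  bilin B u v = \sum_j \sum_i u 0 i * B i j * v 0 j.
Proof.
rewrite /bilin mxE; apply: eq_bigr => j _.
by rewrite !mxE mulr_suml; apply: eq_bigr.
Qed.

Let bilinDl (B : 'M[R]_m) (u v w : 'rV[R]_m) :
  bilin B (u + v) w = bilin B u w + bilin B v w.
Proof. by rewrite /bilin !mulmxDl mxE. Qed.

Let bilinDr (B : 'M[R]_m) (u v w : 'rV[R]_m) :
  bilin B u (v + w) = bilin B u v + bilin B u w.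
Proof. by rewrite /bilin linearD mulmxDr mxE. Qed.

Let bilin_coord (B : 'M[R]_m) (u w : 'rV[R]_m) :
  bilin B u w = \sum_k w 0 k * bilin B u (coord_vec R k).
Proof.
rewrite {1}/bilin mxE; apply: eq_bigr => k _.
by rewrite /bilin /coord_vec trmx_delta -colE !mxE mulrC.
Qed.

Let bilin_sym (x u v : 'rV[R]_m) : U x -> bilin (g x) u v = bilin (g x) v u.
Proof. by move=> Ux; have [+ _] := g_inner Ux; apply. Qed.

Let g_unit (x : 'rV[R]_m) : U x -> g x \in unitmx.
Proof.
move=> Ux; rewrite -row_free_unit; apply/row_freeP.
have [_ gpos] := g_inner Ux.
suff : kermx (g x) == 0.
  by rewrite kermx_eq0 => /row_freeP.
apply/eqP/row_matrixP => i; rewrite row0; apply/eqP/negPn/negP => v0.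
have := gpos _ v0; rewrite /bilin.
by rewrite (sub_kermxP (row_sub i (kermx (g x)))) mul0mx mxE ltxx.
Qed.

Let g_diff (x : 'rV[R]_m) : U x -> differentiable g x.
Proof. by move=> Ux; have [+ _] := g_smooth 1; apply. Qed.

Let derivable_entry p q (F : 'rV[R]_m -> 'M[R]_(p, q)) (x u : 'rV[R]_m) i j :
  derivable F x u -> derivable (fun y => F y i j) x u.
Proof. by move=> /derivable_mxP; apply. Qed.

Let derive_bilin (F : 'rV[R]_m -> 'M[R]_m) (Y Z : 'rV[R]_m -> 'rV[R]_m)
    (x u : 'rV[R]_m) :
  derivable F x u -> derivable Y x u -> derivable Z x u ->
  'D_u (fun y => bilin (F y) (Y y) (Z y)) x
  = bilin ('D_u F x) (Y x) (Z x) + bilin (F x) ('D_u Y x) (Z x)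
    + bilin (F x) (Y x) ('D_u Z x).
Proof.
move=> dF dY dZ.
have -> : (fun y => bilin (F y) (Y y) (Z y)) =
   \sum_j \sum_i ((fun y => Y y 0 i) * (fun y => F y i j) * (fun y => Z y 0 j)).
  apply/funext => y; rewrite bilinE fct_sumE; apply: eq_bigr => j _.
  by rewrite fct_sumE.
have dt j i : derivable
   ((fun y => Y y 0 i) * (fun y => F y i j) * (fun y => Z y 0 j)) x u.
  by apply: derivableM; [apply: derivableM|]; apply: derivable_entry.
rewrite derive_sum; last by move=> j; apply: derivable_sum.
rewrite !bilinE -!big_split; apply: eq_bigr => j _ /=.
rewrite derive_sum // -!big_split; apply: eq_bigr => i _ /=.
rewrite deriveM; [|by apply: derivableM; apply: derivable_entry
  |exact: derivable_entry].
rewrite deriveM; [|exact: derivable_entry..].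
rewrite (derive_mx dF) (derive_mx dY) (derive_mx dZ) !mxE /GRing.scale /=.
rewrite fctE.
move: ('D_u (fun y => Z y 0 j) x) ('D_u (fun y => F y i j) x)
  ('D_u (fun y => Y y 0 i) x) => dz df dy.
by ring.
Qed.

Let dbilin (x u v w : 'rV[R]_m) : U x ->
  'D_u (fun y => bilin (g y) v w) x = bilin ('D_u g x) v w.
Proof.
move=> Ux; rewrite (@derive_bilin g (cst v) (cst w)).
- by rewrite !derive_cst /bilin linear0 !(mul0mx, mulmx0) !mxE !addr0.
- exact/diff_derivable/g_diff.
- exact: derivable_cst.
- exact: derivable_cst.
Qed.

Let dbilin_sym (x u v w : 'rV[R]_m) : U x ->
  'D_u (fun y => bilin (g y) v w) x = 'D_u (fun y => bilin (g y) w v) x.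
Proof.
move=> Ux; apply: near_eq_derive.
near=> y; apply: bilin_sym; near: y.
exact: open_nbhs_nbhs.
Unshelve. all: by end_near. Qed.

Let christoffel_sym (x u v : 'rV[R]_m) : U x ->
  christoffel g x u v = christoffel g x v u.
Proof.
move=> Ux; rewrite /christoffel; congr (_ *m _); apply/rowP => k; rewrite !mxE.
by rewrite /christoffel1 (dbilin_sym _ u v Ux) [X in X - _]addrC.
Qed.

Let christoffelE (x u v w : 'rV[R]_m) : U x ->
  bilin (g x) (christoffel g x u v) w = christoffel1 g x u v w.
Proof.
move=> Ux; rewrite /christoffel /bilin mulmxKV ?g_unit// mxE.
transitivity (\sum_k w 0 k * christoffel1 g x u v (coord_vec R k)).
  by apply: eq_bigr => k _; rewrite !mxE mulrC.
rewrite /christoffel1; under eq_bigr do rewrite mulrCA.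
rewrite -mulr_sumr; congr (_ * _).
under eq_bigr do rewrite mulrBr mulrDr !(dbilin _ _ (coord_vec R _) Ux).
rewrite sumrB big_split /= -!bilin_coord -!(dbilin _ _ w Ux); congr (_ - _).
have dgw : differentiable (fun y => bilin (g y) u v) x.
  have -> : (fun y => bilin (g y) u v) =
     \sum_j \sum_i (fun y => u 0 i * g y i j * v 0 j).
    apply/funext => y; rewrite bilinE fct_sumE; apply: eq_bigr => j _.
    by rewrite fct_sumE.
  apply: differentiable_sum => j; apply: differentiable_sum => i.
  have dg : differentiable (fun y => g y i j) x.
    exact: (differentiable_comp (g_diff Ux) (differentiable_coord _ _ _)).
  by apply: differentiableM => //; apply: differentiableM.
rewrite deriveE// {2}(row_sum_delta w) linear_sum.
by apply: eq_bigr => k _; rewrite linearZ /= -deriveE.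
Qed.

Lemma nabla_torsion_free (X Y : 'rV[R]_m -> 'rV[R]_m) (x : 'rV[R]_m) :
  U x -> nabla g X Y x - nabla g Y X x = bracket X Y x.
Proof.
move=> Ux; rewrite /nabla /bracket (christoffel_sym (Y x) (X x) Ux).
by rewrite opprD addrACA subrr addr0.
Qed.

Lemma nabla_metric (X Y Z : 'rV[R]_m -> 'rV[R]_m) (x : 'rV[R]_m) :
  U x -> differentiable Y x -> differentiable Z x ->
  apply_field X (metric g Y Z) x
  = metric g (nabla g X Y) Z x + metric g Y (nabla g X Z) x.
Proof.
move=> Ux dY dZ; rewrite /apply_field /metric derive_bilin;
  [|exact/diff_derivable/g_diff|exact/diff_derivable..].
rewrite /nabla bilinDl bilinDr [in RHS]addrACA.
rewrite [X in _ + (_ + X)]bilin_sym// !christoffelE// /christoffel1.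
rewrite (dbilin_sym (X x) (Z x) (Y x) Ux) !dbilin//.
by field.
Qed.

End LeviCivita.

(* Identities between tensor fields are required in every chart and for all
   vector fields X, Y defined on that chart; both sides being tensorial in X
   and Y, this is the same as requiring them for global vector fields. *)
Definition in_charts (R : realType) (m : nat) (M : topologicalType)
    (A : smooth_atlas R m M)
    (P : chart A -> ('rV[R]_m -> 'rV[R]_m) -> ('rV[R]_m -> 'rV[R]_m) ->
         'rV[R]_m -> Prop) : Prop :=
  forall a X Y, smooth_on (img a) X -> smooth_on (img a) Y ->
  forall x, img a x -> P a X Y x.

Section Kenmotsu.
Variables (R : realType) (n : nat) (M : topologicalType).
Local Notation m := (2 * n).+1.
Variable A : smooth_atlas R m M.
Implicit Types (phi : chart A -> 'rV[R]_m -> 'M[R]_m)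
  (xi : chart A -> 'rV[R]_m -> 'rV[R]_m)
  (eta : chart A -> 'rV[R]_m -> 'cV[R]_m)
  (g : chart A -> 'rV[R]_m -> 'M[R]_m)
  (V : chart A -> 'rV[R]_m -> 'rV[R]_m).

Definition almost_contact phi xi eta : Prop :=
  [/\ tensor11 phi, vector_field xi, one_form eta,
      forall a x v, img a x ->
        endo (phi a x) (endo (phi a x) v) = - v + covec (eta a x) v *: xi a x &
      forall a x, img a x -> covec (eta a x) (xi a x) = 1].

Definition compatible phi eta g : Prop :=
  in_charts (fun a X Y x =>
    bilin (g a x) (endo (phi a x) (X x)) (endo (phi a x) (Y x))
    = bilin (g a x) (X x) (Y x)
      - covec (eta a x) (X x) * covec (eta a x) (Y x)).

Definition almost_contact_metric phi xi eta g : Prop :=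
  [/\ almost_contact phi xi eta, riemannian_metric g & compatible phi eta g].

Definition kenmotsu phi xi eta g : Prop :=
  almost_contact_metric phi xi eta g /\
  in_charts (fun a X Y x =>
    nabla_endo (g a) (phi a) X Y x
    = bilin (g a x) (endo (phi a x) (X x)) (Y x) *: xi a x
      - covec (eta a x) (Y x) *: endo (phi a x) (X x)).

Definition eta_einstein eta g : Prop :=
  exists alpha beta : M -> R,
    [/\ smooth_fun A alpha, smooth_fun A beta &
      in_charts (fun a X Y x =>
        ricci (g a) X Y x
        = alpha (point a x) * bilin (g a x) (X x) (Y x)
          + beta (point a x)
            * (covec (eta a x) (X x) * covec (eta a x) (Y x)))].

Definition eta_ricci_soliton eta g V : Prop :=
  exists lambda mu : R,
    in_charts (fun a X Y x =>
      2^-1 * lie_metric (V a) (g a) X Y x + ricci (g a) X Y x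
      + lambda * bilin (g a x) (X x) (Y x)
      + mu * (covec (eta a x) (X x) * covec (eta a x) (Y x)) = 0).

Definition einstein g : Prop :=
  exists c : R,
    in_charts (fun a X Y x =>
      ricci (g a) X Y x = c * bilin (g a x) (X x) (Y x)).

End Kenmotsu.

(* Main.v *)
From HB Require Import structures.
Require Import Defs.
From mathcomp Require Import all_boot all_order all_algebra.
From mathcomp Require Import all_classical all_reals all_analysis.
From mathcomp Require Import ring.
Import Order.TTheory GRing.Theory Num.Theory.
Import numFieldNormedType.Exports.

(** The conclusion is local, and the argument takes place in one chart. A
    Kenmotsu structure satisfies nabla_X xi = X - eta(X) xi, whence
    R(X, Y) xi = eta(X) Y - eta(Y) X and Ric(X, xi) = -2n eta(X). Comparing
    with Ric = alpha g + beta eta (x) eta gives alpha + beta = -2n, so that the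
    whole theorem amounts to beta = 0.

    Schur's argument comes first: the twice contracted second Bianchi identity
    d r = 2 div Ric, applied to the eta-Einstein form of Ric, yields
    (n - 1) d beta = - 2 (n - 1) beta eta, and n > 1 gives d beta = -2 beta eta
    (lemma schur_eta).

    The soliton equation then produces a very rigid vector field. Let
    k = 2n - lambda - mu, f = eta(V) and W = [V, xi] + k xi. The soliton
    equation evaluated on xi says that W is the gradient of f minus k xi, and
    that W is orthogonal to xi. Expanding the Lie derivative of g along [V, xi]
    as a commutator of L_V, given by the soliton equation, and of L_xi, which
    maps g to 2 (g - eta (x) eta), determines the Hessian of f:
      nabla_X W = (k + 2 beta) (X - eta(X) xi) - g(W, X) xi - eta(X) W
    (lemma soliton_field). In the local picture, where M is a warped product
    of an interval and an Einstein manifold N, the function f has on N a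
    Hessian proportional to the metric of N.

    Differentiating once more gives R(X, Y) W, and by a trace
    Ric(X, W) = -2n (2 k eta(X) + g(W, X)). The eta-Einstein condition turns
    this into beta g(W, X) = 4 n k eta(X). For X = xi this is k = 0. Hence
    beta W = 0; by the formula for nabla W, differentiating beta W = 0 and
    taking the trace leads to beta ^ 3 = 0, and finally beta = 0.

    All these steps are identities between multilinear expressions in vector
    fields. They are therefore proved over an arbitrary commutative ring C of
    scalars acted upon by a module of fields, from the rules of the
    Levi-Civita calculus alone (record riemannian_calculus). Only two
    properties of C matter besides: it has no additive torsion and no
    nilpotent. It has zero divisors, which is why the end of the proof passes
    through beta ^ 3 = 0 rather than through the alternative beta = 0 or
    W = 0. The analytic part of the file builds the ring of smooth functions on
    an open set of R^m, with its commuting partial derivatives, and interprets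
    row vectors over this ring as vector fields; smoothness of Christoffel
    symbols and of iterated covariant derivatives is then automatic. *)

Set Implicit Arguments.
Unset Strict Implicit.
Unset Printing Implicit Defensive.

Local Open Scope ring_scope.

(** * Riemannian geometry over a commutative ring of scalars *)

Lemma addr_idem0 (V : zmodType) (x : V) : x = x + x -> x = 0.
Proof. by move/(congr1 (fun y => y - x)); rewrite addrK subrr. Qed.

(** The rules of the Levi-Civita connection on a parallelizable open set. The
    fields form a module X over the ring C of scalars, act u f is the derivative
    of f along u, nab the connection and met the metric. The bracket is not a
    primitive: as the connection has no torsion, it is nab u v - nab v u. The
    coframe is the metric dual of the frame, so that traces with respect to the
    metric are sums over pairs (frame i, coframe i) and no inverse matrix is
    needed to state them. *)
Record riemannian_calculus (C : comPzRingType) (X : lmodType C) (d : nat) :=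
    RiemannianCalculus {
  act : X -> C -> C ;
  nab : X -> X -> X ;
  met : X -> X -> C ;
  frame : 'I_d -> X ;
  coframe : 'I_d -> X ;
  actD : forall u f h, act u (f + h) = act u f + act u h ;
  actM : forall u f h, act u (f * h) = act u f * h + f * act u h ;
  act_lin : forall f u v h, act (f *: u + v) h = f * act u h + act v h ;
  nabDr : forall u v w, nab u (v + w) = nab u v + nab u w ;
  nabZr : forall u f v, nab u (f *: v) = act u f *: v + f *: nab u v ;
  nab_lin : forall f u v w, nab (f *: u + v) w = f *: nab u w + nab v w ;
  metC : forall u v, met u v = met v u ;
  met_lin : forall f u v w, met (f *: u + v) w = f * met u w + met v w ;
  act_met : forall u v w,
    act u (met v w) = met (nab u v) w + met v (nab u w) ;
  act_br : forall u v f,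
    act (nab u v - nab v u) f = act u (act v f) - act v (act u f) ;
  jacobi : forall u v w,
    let br a b := nab a b - nab b a in
    br u (br v w) + br v (br w u) + br w (br u v) = 0 ;
  frame_expand : forall v, v = \sum_i met v (coframe i) *: frame i ;
  frame_dual : forall i j, met (frame i) (coframe j) = (i == j)%:R
}.

Section RiemannianCalculus.
Variables (C : comPzRingType) (X : lmodType C) (d : nat).
Variable G : riemannian_calculus X d.
Implicit Types (u v w z a b c : X) (f h : C).
Local Notation act := (act G).
Local Notation nab := (nab G).
Local Notation met := (met G).
Local Notation e := (frame G).
Local Notation e' := (coframe G).

Definition br u v := nab u v - nab v u.

Lemma actDl u v f : act (u + v) f = act u f + act v f.
Proof. by rewrite -[u]scale1r act_lin mul1r scale1r. Qed.
Lemma act0l f : act 0 f = 0.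
Proof. by apply: addr_idem0; rewrite -(actDl 0 0 f) addr0. Qed.
Lemma actZl h u f : act (h *: u) f = h * act u f.
Proof. by rewrite -[h *: u]addr0 act_lin act0l addr0. Qed.
Lemma actNl u f : act (- u) f = - act u f.
Proof. by rewrite -scaleN1r actZl mulN1r. Qed.
Lemma act0 u : act u 0 = 0.
Proof. by apply: addr_idem0; rewrite -(actD G u 0 0) addr0. Qed.
Lemma actN u f : act u (- f) = - act u f.
Proof. by apply/eqP; rewrite -addr_eq0 -actD addNr act0. Qed.
Lemma actB u f h : act u (f - h) = act u f - act u h.
Proof. by rewrite actD actN. Qed.
Lemma act1 u : act u 1 = 0.
Proof. by have := actM G u 1 1; rewrite !mul1r mulr1 => /addr_idem0. Qed.
Lemma act_nat u k : act u k%:R = 0.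
Proof. by elim: k => [|k IH]; rewrite ?act0// -addn1 natrD actD IH act1 addr0. Qed.
Lemma act_sum u I (r : seq I) (F : I -> C) :
  act u (\sum_(i <- r) F i) = \sum_(i <- r) act u (F i).
Proof. exact: (big_morph (act u) (actD G u) (act0 u)). Qed.

Lemma nabDl u v w : nab (u + v) w = nab u w + nab v w.
Proof. by rewrite -[u]scale1r nab_lin !scale1r. Qed.
Lemma nab0l w : nab 0 w = 0.
Proof. by apply: addr_idem0; rewrite -(nabDl 0 0 w) addr0. Qed.
Lemma nabZl h u w : nab (h *: u) w = h *: nab u w.
Proof. by rewrite -[h *: u]addr0 nab_lin nab0l addr0. Qed.
Lemma nabNl u w : nab (- u) w = - nab u w.
Proof. by rewrite -scaleN1r nabZl scaleN1r. Qed.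
Lemma nab0r u : nab u 0 = 0.
Proof. by apply: addr_idem0; rewrite -(nabDr G u 0 0) addr0. Qed.
Lemma nabNr u w : nab u (- w) = - nab u w.
Proof. by apply/eqP; rewrite -addr_eq0 -nabDr addNr nab0r. Qed.

Lemma metDl u v w : met (u + v) w = met u w + met v w.
Proof. by rewrite -[u]scale1r met_lin mul1r scale1r. Qed.
Lemma met0l w : met 0 w = 0.
Proof. by apply: addr_idem0; rewrite -(metDl 0 0 w) addr0. Qed.
Lemma metZl h u w : met (h *: u) w = h * met u w.
Proof. by rewrite -[h *: u]addr0 met_lin met0l addr0. Qed.
Lemma metNl u w : met (- u) w = - met u w.
Proof. by rewrite -scaleN1r metZl mulN1r. Qed.
Lemma metDr u v w : met u (v + w) = met u v + met u w.
Proof. by rewrite !(metC G u) metDl. Qed.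
Lemma met0r u : met u 0 = 0.
Proof. by rewrite metC met0l. Qed.
Lemma metZr u h v : met u (h *: v) = h * met u v.
Proof. by rewrite !(metC G u) metZl. Qed.
Lemma metNr u v : met u (- v) = - met u v.
Proof. by rewrite !(metC G u) metNl. Qed.
Lemma met_suml w I (r : seq I) (F : I -> X) :
  met (\sum_(i <- r) F i) w = \sum_(i <- r) met (F i) w.
Proof. exact: (big_morph (met^~ w) (fun u v => metDl u v w) (met0l w)). Qed.

Definition actE := (actDl, actNl, actZl, act0l, actD, actN, act0, act1, act_nat).
Definition nabE := (nabDl, nabNl, nabZl, nab0l, nabDr, nabNr, nabZr, nab0r).
Definition metE := (metDl, metNl, metZl, met0l, metDr, metNr, metZr, met0r).

Lemma met_inj u v : (forall w, met u w = met v w) -> u = v.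
Proof.
move=> uv; rewrite (frame_expand G u) (frame_expand G v).
by apply: eq_bigr => i _; rewrite uv.
Qed.

Definition curv u v w := nab u (nab v w) - nab v (nab u w) - nab (br u v) w.
Definition curv4 u v w z := met (curv u v w) z.

Lemma curv4D1 u u' v w z : curv4 (u + u') v w z = curv4 u v w z + curv4 u' v w z.
Proof. rewrite /curv4 /curv /br !nabE !metE; ring. Qed.
Lemma curv4Z1 f u v w z : curv4 (f *: u) v w z = f * curv4 u v w z.
Proof. rewrite /curv4 /curv /br !nabE !metE; ring. Qed.
Lemma curv4_anti12 u v w z : curv4 v u w z = - curv4 u v w z.
Proof. rewrite /curv4 /curv /br !nabE !metE; ring. Qed.
Lemma curv4D3 u v w w' z : curv4 u v (w + w') z = curv4 u v w z + curv4 u v w' z.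
Proof. rewrite /curv4 /curv /br !nabE !metE; ring. Qed.
(** The second derivatives of f cancel because nab u v - nab v u acts as the
    commutator of u and v. *)
Lemma curv4Z3 u v f w z : curv4 u v (f *: w) z = f * curv4 u v w z.
Proof.
rewrite /curv4 /curv /br !nabE !metE.
have := act_br G u v f; rewrite !actE => h.
have -> : act (nab u v) f = act u (act v f) - act v (act u f) + act (nab v u) f.
  by rewrite -h subrK.
ring.
Qed.
Lemma curv4D4 u v w z z' : curv4 u v w (z + z') = curv4 u v w z + curv4 u v w z'.
Proof. by rewrite /curv4 metDr. Qed.
Lemma curv4Z4 u v w f z : curv4 u v w (f *: z) = f * curv4 u v w z.
Proof. by rewrite /curv4 metZr. Qed.

(** The commutator of u and v acts on met w z as the bracket does; the Leibniz
    rule for the metric turns this into skew-symmetry of the curvature. *)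
Lemma curv4_anti34 u v w z : curv4 u v z w = - curv4 u v w z.
Proof.
have := act_br G u v (met w z); rewrite !actE !act_met !actE !act_met => h.
apply/eqP; rewrite -addr_eq0; apply/eqP.
rewrite /curv4 /curv /br !nabE !metE.
rewrite (metC G _ w) (metC G (nab v (nab u z)) w) (metC G (nab (nab u v) z) w)
  (metC G (nab (nab v u) z) w).
move/eqP: h; rewrite -subr_eq0 => /eqP h.
rewrite -[RHS]oppr0 -[X in _ = - X]h; ring.
Qed.

(** For a torsion-free connection this is the Jacobi identity. *)
Lemma bianchi1 u v w z : curv4 u v w z + curv4 v w u z + curv4 w u v z = 0.
Proof.
have /(congr1 (met ^~ z)) := jacobi G u v w.
rewrite /= /curv4 /curv /br !nabE !metE => <-; ring.
Qed.

(** The octahedron argument: an alternating sum of the first Bianchi identity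
    over four faces leaves twice the difference of the two sides. *)
Lemma curv4_pair (u v w z : X) : (forall f : C, f *+ 2 = 0 -> f = 0) ->
  curv4 u v w z = curv4 w z u v.
Proof.
move=> regular2; apply/eqP; rewrite -subr_eq0; apply/eqP/regular2.
transitivity ((curv4 u v w z + curv4 v w u z + curv4 w u v z)
  + (curv4 v w z u + curv4 w z v u + curv4 z v w u)
  - (curv4 w z u v + curv4 z u w v + curv4 u w z v)
  - (curv4 z u v w + curv4 u v z w + curv4 v z u w)); last first.
  by rewrite !bianchi1; ring.
rewrite (curv4_anti34 v w u z) (curv4_anti34 w z u v) (curv4_anti12 w u z v).
rewrite (curv4_anti34 w u v z) (curv4_anti34 z u w v) (curv4_anti34 u v w z).
rewrite (curv4_anti12 z v u w) (curv4_anti34 z v w u); ring.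
Qed.

(** The covariant derivative along a of the curvature, as a tensor with four
    arguments. *)
Definition nabla_curv4 a u v w z := act a (curv4 u v w z) - curv4 (nab a u) v w z
  - curv4 u (nab a v) w z - curv4 u v (nab a w) z - curv4 u v w (nab a z).

Lemma nabla_curv4_anti12 a u v w z : nabla_curv4 a v u w z = - nabla_curv4 a u v w z.
Proof.
rewrite /nabla_curv4 (curv4_anti12 u v) (curv4_anti12 u (nab a v)).
rewrite (curv4_anti12 (nab a u)) (curv4_anti12 u v (nab a w)).
rewrite (curv4_anti12 u v w (nab a z)) actN; ring.
Qed.

(** The Jacobi identity for the operators nab a, nab b and nab c: the sum of
    the double commutators vanishes, and what remains is nab along a Jacobi sum
    of brackets. *)
Lemma bianchi2 a b c w z :
  nabla_curv4 a b c w z + nabla_curv4 b c a w z + nabla_curv4 c a b w z = 0.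
Proof.
have jac := congr1 (fun u => met (nab u w) z) (jacobi G a b c).
rewrite /nabla_curv4 /curv4 !act_met /curv /br.
rewrite /= !nabE !metE in jac.
rewrite !nabE !metE -[RHS]oppr0 -[X in _ = - X]jac; ring.
Qed.

Lemma dual_expand v : v = \sum_i met v (e i) *: e' i.
Proof.
apply: met_inj => w; rewrite met_suml metC {1}(frame_expand G w) met_suml.
by apply: eq_bigr => i _; rewrite !metZl mulrC (metC G w) (metC G v).
Qed.

Section Traces.
Variable B : X -> X -> C.
Hypothesis B_linl : forall f u v w, B (f *: u + v) w = f * B u w + B v w.
Hypothesis B_linr : forall f u v w, B w (f *: u + v) = f * B w u + B w v.

Let BDl u v w : B (u + v) w = B u w + B v w.
Proof. by rewrite -[u]scale1r B_linl mul1r scale1r. Qed.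
Let B0l w : B 0 w = 0.
Proof. by apply: addr_idem0; rewrite -BDl addr0. Qed.
Let BDr u v w : B w (u + v) = B w u + B w v.
Proof. by rewrite -[u]scale1r B_linr mul1r scale1r. Qed.
Let B0r w : B w 0 = 0.
Proof. by apply: addr_idem0; rewrite -BDr addr0. Qed.
Let B_suml w (F : 'I_d -> C) (u : 'I_d -> X) :
  B (\sum_i F i *: u i) w = \sum_i F i * B (u i) w.
Proof.
rewrite (big_morph (B^~ w) (fun u v => BDl u v w) (B0l w)).
by apply: eq_bigr => i _; rewrite -[_ *: _]addr0 B_linl B0l addr0.
Qed.
Let B_sumr w (F : 'I_d -> C) (u : 'I_d -> X) :
  B w (\sum_i F i *: u i) = \sum_i F i * B w (u i).
Proof.
rewrite (big_morph (B w) (fun u v => BDr u v w) (B0r w)).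
by apply: eq_bigr => i _; rewrite -[_ *: _]addr0 B_linr B0r addr0.
Qed.

(** The trace of B is a contraction with the inverse metric, which is
    symmetric. *)
Lemma trace_swap : \sum_i B (e i) (e' i) = \sum_i B (e' i) (e i).
Proof.
under eq_bigr => i _ do rewrite (frame_expand G (e' i)) B_sumr.
under [RHS]eq_bigr => i _ do rewrite (frame_expand G (e' i)) B_suml.
rewrite [RHS]exchange_big /=; apply: eq_bigr => i _; apply: eq_bigr => j _.
by rewrite metC.
Qed.

(** The inverse metric is parallel, hence contractions commute with covariant
    derivatives: the derivatives of the frame and of the coframe cancel by
    differentiating frame_dual. *)
Lemma act_trace a : act a (\sum_i B (e i) (e' i)) =
  \sum_i (act a (B (e i) (e' i)) - B (nab a (e i)) (e' i) - B (e i) (nab a (e' i))).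
Proof.
rewrite act_sum !sumrB -addrA -opprD.
suff -> : \sum_i B (nab a (e i)) (e' i) + \sum_i B (e i) (nab a (e' i)) = 0.
  by rewrite subr0.
under eq_bigr => i _ do rewrite (frame_expand G (nab a (e i))) B_suml.
under [X in _ + X]eq_bigr => i _ do rewrite (dual_expand (nab a (e' i))) B_sumr.
rewrite [X in _ + X]exchange_big -big_split big1 //= => i _.
rewrite -big_split big1 //= => j _; rewrite -mulrDl.
have := act_met G a (e i) (e' j); rewrite frame_dual act_nat => h.
by rewrite (metC G (nab a (e' j))) -h mul0r.
Qed.

End Traces.

Lemma trace_met : \sum_i met (e i) (e' i) = d%:R.
Proof.
under eq_bigr => i _ do rewrite frame_dual eqxx.
by rewrite sumr_const card_ord.
Qed.

(** The trace of the endomorphism u |-> l(u) v is l(v). *)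
Lemma trace_prod (l : X -> C) v : (forall f u w, l (f *: u + w) = f * l u + l w) ->
  \sum_i l (e i) * met v (e' i) = l v.
Proof.
move=> ll; have l0 : l 0 = 0.
  by apply: addr_idem0; rewrite -[X in _ = X + _]mul1r -ll scaler0 addr0.
rewrite {2}(frame_expand G v) (big_morph l (_ : {morph l : u w / u + w}) l0).
  by apply: eq_bigr => i _; rewrite -[_ *: _]addr0 ll l0 addr0 mulrC.
by move=> u w; rewrite -[u]scale1r ll mul1r scale1r.
Qed.

Definition ric v w := \sum_i curv4 (e i) v w (e' i).
Definition nabla_ric a v w := act a (ric v w) - ric (nab a v) w - ric v (nab a w).
Definition scal_curv := \sum_i ric (e i) (e' i).

Lemma nabla_ricE a v w : nabla_ric a v w = \sum_i nabla_curv4 a (e i) v w (e' i).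
Proof.
rewrite /nabla_ric /ric (@act_trace (fun x y => curv4 x v w y)); first last.
- by move=> *; rewrite curv4D4 curv4Z4.
- by move=> *; rewrite curv4D1 curv4Z1.
rewrite -!sumrB; apply: eq_bigr => i _; rewrite /nabla_curv4; ring.
Qed.

Lemma ric_linl f u v w : ric (f *: u + v) w = f * ric u w + ric v w.
Proof.
rewrite mulr_sumr -big_split; apply: eq_bigr => i _.
rewrite !(curv4_anti12 _ (e i)) curv4D1 curv4Z1 /=; ring.
Qed.
Lemma ric_linr f u v w : ric w (f *: u + v) = f * ric w u + ric w v.
Proof.
rewrite mulr_sumr -big_split; apply: eq_bigr => i _.
by rewrite curv4D3 curv4Z3.
Qed.

Section Regular.
Hypothesis regular2 : forall f : C, f *+ 2 = 0 -> f = 0.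

Lemma nabla_curv4_pair a u v w z : nabla_curv4 a u v w z = nabla_curv4 a w z u v.
Proof.
rewrite /nabla_curv4 (curv4_pair u) // (curv4_pair (nab a u)) //.
rewrite (curv4_pair u (nab a v)) // (curv4_pair u v (nab a w)) //.
rewrite (curv4_pair u v w (nab a z)) //; ring.
Qed.

(** Twice contracted second Bianchi identity, d r = 2 div Ric. The two sums on
    the right are both the divergence of Ric, written with the two orders of
    the frame and the coframe. *)
Lemma contracted_bianchi a :
  act a scal_curv = \sum_j nabla_ric (e j) (e' j) a + \sum_j nabla_ric (e' j) a (e j).
Proof.
have trace2 : act a scal_curv = \sum_j nabla_ric a (e' j) (e j).
  rewrite /scal_curv (trace_swap ric_linl ric_linr).
  rewrite (@act_trace (fun x y => ric y x)); first last.
  - by move=> *; rewrite ric_linl.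
  - by move=> *; rewrite ric_linr.
  by apply: eq_bigr => j _; rewrite addrAC.
apply/eqP; rewrite eq_sym -subr_eq0 trace2; apply/eqP.
under [X in X + _ - _]eq_bigr do rewrite nabla_ricE.
rewrite [X in X + _ - _]exchange_big -big_split -sumrB big1 //= => j _.
rewrite !nabla_ricE -big_split -sumrB big1 //= => i _.
(* The second Bianchi identity is contracted over its first and last arguments,
   and over the third and fourth. *)
rewrite -(bianchi2 (e i) a (e' j) (e j) (e' i)).
rewrite (nabla_curv4_pair (e i) a) (nabla_curv4_anti12 a (e i)); ring.
Qed.

End Regular.

(** The Lie derivative of the metric along a; lie_metE gives its usual
    definition by brackets. *)
Definition lie_met a u v := met (nab u a) v + met u (nab v a).

Lemma lie_metE a u v :
  lie_met a u v = act a (met u v) - met (br a u) v - met u (br a v).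
Proof. rewrite /lie_met /br act_met !metE; ring. Qed.

(** L_[a, b] = L_a L_b - L_b L_a on the metric; everything else cancels by the
    Jacobi identity. *)
Lemma lie_met_br a b u v : lie_met (br a b) u v =
  (act a (lie_met b u v) - lie_met b (br a u) v - lie_met b u (br a v)) -
  (act b (lie_met a u v) - lie_met a (br b u) v - lie_met a u (br b v)).
Proof.
have ju := congr1 (fun x => met x v) (jacobi G a b u).
have jv := congr1 (fun x => met u x) (jacobi G a b v).
have ab := act_br G a b (met u v).
rewrite !lie_metE /br ab !actB.
rewrite /= !metE !nabE in ju jv; rewrite !metE !nabE !metE in ju jv *.
apply/eqP; rewrite -subr_eq0 -(addr0 0) -{1}ju -jv; apply/eqP; ring.
Qed.

End RiemannianCalculus.

(** * Kenmotsu structures and eta-Ricci solitons, algebraically *)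

Section Kenmotsu.
Variables (C : comPzRingType) (X : lmodType C) (n : nat).
Variable G : riemannian_calculus X (2 * n).+1.
Implicit Types (u v w z : X) (f : C).
Local Notation act := (act G).
Local Notation nab := (nab G).
Local Notation met := (met G).
Local Notation br := (br G).
Local Notation e := (frame G).
Local Notation e' := (coframe G).
Local Notation metE := (metE G).
Local Notation nabE := (nabE G).

Hypothesis regular : forall k f, f *+ k.+1 = 0 -> f = 0.
Hypothesis reduced : forall f, f * f = 0 -> f = 0.

Section Structure.
Variables (phi : X -> X) (xi : X) (eta : X -> C).
Hypothesis phi_lin : forall f u v, phi (f *: u + v) = f *: phi u + phi v.
Hypothesis eta_lin : forall f u v, eta (f *: u + v) = f * eta u + eta v.
Hypothesis phi2 : forall u, phi (phi u) = - u + eta u *: xi.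
Hypothesis eta_xi : eta xi = 1.
Hypothesis phi_met : forall u v, met (phi u) (phi v) = met u v - eta u * eta v.
Hypothesis nab_phi : forall u v,
  nab u (phi v) - phi (nab u v) = met (phi u) v *: xi - eta v *: phi u.

Let phi0 : phi 0 = 0.
Proof.
by apply: addr_idem0; rewrite -[X in _ = X + _]scale1r -phi_lin scale1r addr0.
Qed.
Let phiZ f u : phi (f *: u) = f *: phi u.
Proof. by rewrite -[f *: u]addr0 phi_lin phi0 addr0. Qed.
Let phiN u : phi (- u) = - phi u.
Proof. by rewrite -scaleN1r phiZ scaleN1r. Qed.
Let phiD u v : phi (u + v) = phi u + phi v.
Proof. by rewrite -[u]scale1r phi_lin !scale1r. Qed.
Let eta0 : eta 0 = 0.
Proof.
by apply: addr_idem0; rewrite -[X in _ = X + _]mul1r -eta_lin scale1r addr0.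
Qed.
Let etaZ f u : eta (f *: u) = f * eta u.
Proof. by rewrite -[f *: u]addr0 eta_lin eta0 addr0. Qed.

(** phi xi is a multiple t xi because phi commutes with phi ^ 2, and t ^ 2 = 0
    because phi ^ 2 kills xi. *)
Let phi_xi : phi xi = 0.
Proof.
have xi2 : phi (phi xi) = 0 by rewrite phi2 eta_xi scale1r addNr.
have xi1 : phi xi = eta (phi xi) *: xi.
  by apply/eqP; rewrite eq_sym -subr_eq0 addrC -phi2 xi2 phi0.
have : eta (phi (phi xi)) = 0 by rewrite xi2 eta0.
by rewrite {1}xi1 phiZ etaZ => /reduced h; rewrite xi1 h scale0r.
Qed.

Lemma eta_met u : eta u = met u xi.
Proof.
have := phi_met u xi; rewrite phi_xi met0r eta_xi mulr1 => /eqP.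
by rewrite eq_sym subr_eq0 => /eqP.
Qed.

Let eta_phi u : eta (phi u) = 0.
Proof.
have := congr1 phi (phi2 u); rewrite phi2 phiD phiN phiZ phi_xi scaler0 addr0.
move=> /(canRL (addKr _)); rewrite opprK addrN => /(congr1 eta).
by rewrite eta0 etaZ eta_xi mulr1.
Qed.

(** The Kenmotsu equation at v = xi reads phi (nab u xi) = phi u. Applying phi
    recovers nab u xi up to its component along xi, which vanishes since xi has
    unit length. *)
Lemma nab_reeb u : nab u xi = u - met u xi *: xi.
Proof.
have xi1 : met xi xi = 1 by rewrite -eta_met.
have eta_nab : eta (nab u xi) = 0.
  apply: (@regular 1); have := act_met G u xi xi.
  by rewrite xi1 act1 (metC _ xi) eta_met mulr2n.
have := nab_phi u xi; rewrite phi_xi nab0r sub0r -eta_met eta_phi scale0r.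
rewrite sub0r eta_xi scale1r => /oppr_inj /(congr1 phi).
rewrite !phi2 eta_nab scale0r addr0 -eta_met => /(canRL opprK) ->.
by rewrite opprD opprK.
Qed.
End Structure.

Section Soliton.
Variable xi : X.
Local Notation eta u := (met u xi).
Hypothesis xi_unit : eta xi = 1.
Hypothesis nab_xi : forall u, nab u xi = u - eta u *: xi.

(** As met u v - eta u * eta v is symmetric in u and v, this also says that the
    form eta is closed. *)
Lemma act_eta u v : act u (eta v) = eta (nab u v) + met u v - eta u * eta v.
Proof. by rewrite act_met nab_xi !metE (metC G v u); ring. Qed.

Lemma curv_xi u v : curv G u v xi = eta u *: v - eta v *: u.
Proof.
apply: (@met_inj _ _ _ G) => w; rewrite /curv /br.
rewrite !nab_xi !nabE !nab_xi !metE !act_eta (metC G v u); ring.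
Qed.

Lemma ric_xi v : ric G v xi = - (2 * n)%:R * eta v.
Proof.
rewrite /ric; under eq_bigr do rewrite /curv4 curv_xi !metE.
rewrite sumrB -mulr_sumr trace_met (@trace_prod _ _ _ G (fun u => eta u)).
  rewrite -[(_.+1)%:R]natr1; ring.
by move=> *; rewrite !metE.
Qed.

Variables al be : C.
Hypothesis ric_eta : forall u v, ric G u v = al * met u v + be * (eta u * eta v).

(** Both expressions of Ric(xi, xi) are compared. *)
Lemma eta_einstein_sum : al = - (2 * n)%:R - be.
Proof.
by have := ric_xi xi; rewrite ric_eta xi_unit !mulr1 => <-; ring.
Qed.

Lemma nabla_ric_eta u v w : nabla_ric G u v w =
  act u al * met v w + act u be * (eta v * eta w)
  + be * ((met u v - eta u * eta v) * eta w + eta v * (met u w - eta u * eta w)).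
Proof.
rewrite /nabla_ric !ric_eta actD !actM !act_eta act_met; ring.
Qed.

Hypothesis n_gt1 : (1 < n)%N.

Let trace_eta (l : X -> C) : (forall f u w, l (f *: u + w) = f * l u + l w) ->
  \sum_i l (e i) * eta (e' i) = l xi.
Proof.
move=> ll; rewrite -(trace_prod G xi ll).
by under [RHS]eq_bigr => i _ do rewrite (metC G xi).
Qed.

(** Schur's lemma. By eta_einstein_sum the scalar curvature is
    - 2n (2n + 1) - 2n beta, so the contracted Bianchi identity is a linear
    relation between d beta, (xi beta) eta and beta eta. Evaluated at xi it gives
    xi beta = - 2 beta; what remains is a multiple of n - 1. *)
Lemma schur_eta u : act u be = - 2 * be * eta u.
Proof.
have e_lin f v w : eta (f *: v + w) = f * eta v + eta w by rewrite !metE.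
have a_lin f v w : act (f *: v + w) be = f * act v be + act w be by rewrite act_lin.
have al_lin f v w : act (f *: v + w) al = f * act v al + act w al by rewrite act_lin.
have m_lin z f v w : met (f *: v + w) z = f * met v z + met w z by rewrite !metE.
have Dal v : act v al = - act v be by rewrite eta_einstein_sum !actE; ring.
have tr1 : \sum_j eta (e j) * eta (e' j) = 1.
  by rewrite (trace_eta e_lin).
have div1 v : \sum_j nabla_ric G (e j) (e' j) v =
    act v al + act xi be * eta v + be * (2 * n)%:R * eta v.
  rewrite -(trace_prod G v al_lin) -(trace_eta a_lin) mulr_suml.
  have -> : (2 * n)%:R = \sum_j (met (e j) (e' j) - eta (e j) * eta (e' j)).
    by rewrite sumrB trace_met tr1 -natr1 addrK.
  have h0 : \sum_j eta (e' j) * (met (e j) v - eta (e j) * eta v) = 0.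
    transitivity (\sum_j met (e j) v * eta (e' j)
      - eta v * \sum_j eta (e j) * eta (e' j)); last first.
      by rewrite (trace_eta (m_lin v)) tr1 mulr1 metC subrr.
    rewrite mulr_sumr -sumrB.
    by apply: eq_bigr => j _; ring.
  rewrite mulr_sumr mulr_suml.
  rewrite -[RHS]addr0 -[X in _ = _ + X](mulr0 be) -[X in _ = _ + be * X]h0.
  rewrite mulr_sumr.
  rewrite -!big_split; apply: eq_bigr => j _ /=.
  rewrite nabla_ric_eta (metC G (e' j) v); ring.
have div2 v : \sum_j nabla_ric G (e' j) v (e j) =
    act v al + act xi be * eta v + be * (2 * n)%:R * eta v.
  rewrite -div1 (@trace_swap _ _ _ G (fun x y => nabla_ric G x y v)); first last.
  - by move=> *; rewrite !nabla_ric_eta !metE; ring.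
  - by move=> *; rewrite !nabla_ric_eta !metE !act_lin; ring.
  by apply: eq_bigr => j _; rewrite !nabla_ric_eta (metC G v); ring.
have dscal_curv v : act v (scal_curv G) = - (2 * n)%:R * act v be.
  have -> : scal_curv G = al * (2 * n).+1%:R + be.
    rewrite /scal_curv; under eq_bigr do rewrite ric_eta.
    by rewrite big_split -!mulr_sumr trace_met tr1 mulr1.
  rewrite actD actM act_nat Dal -natr1; ring.
(* The contracted Bianchi identity, with alpha eliminated. *)
have key v : (act v be * (2 * n)%:R + act xi be * eta v *+ 2
    + (2 * n)%:R * be * eta v *+ 2) = act v be *+ 2.
  have := contracted_bianchi G (@regular 1) v.
  rewrite div1 div2 dscal_curv Dal => /eqP; rewrite -subr_eq0 => /eqP h.
  by apply/eqP; rewrite -subr_eq0; apply/eqP; rewrite -[RHS]oppr0 -h; ring.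
have n0 : (2 * n)%:R = n%:R *+ 2 :> C by rewrite natrM; ring.
have dxi : act xi be = - 2 * be.
  apply/eqP; rewrite -subr_eq0; apply/eqP.
  apply: (@regular (2 * n).-1); rewrite prednK ?muln_gt0 ?(ltnW n_gt1) //.
  have := key xi; rewrite xi_unit => /eqP; rewrite -subr_eq0 => /eqP h.
  by rewrite -[RHS]h -[LHS]mulr_natr n0; ring.
apply/eqP; rewrite -subr_eq0; apply/eqP.
apply: (@regular (2 * (n - 1)).-1).
rewrite prednK ?muln_gt0 ?subn_gt0 ?n_gt1 //.
have := key u; rewrite dxi => /eqP; rewrite -subr_eq0 => /eqP h.
rewrite -[RHS]h n0 -[LHS]mulr_natr natrM natrB ?(ltnW n_gt1) //; ring.
Qed.

Variables (la mu : C) (V : X).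
Hypothesis la_const : forall u, act u la = 0.
Hypothesis mu_const : forall u, act u mu = 0.
Hypothesis soliton : forall u v, lie_met G V u v
  + (ric G u v + la * met u v + mu * (eta u * eta v)) *+ 2 = 0.

(** By the soliton equation, (L_V g)(u, xi) = 2 k eta(u). *)
Let k := (2 * n)%:R - la - mu.
Let f := met V xi.
Let W := br V xi + k *: xi.

Let lieV u v : lie_met G V u v =
  - 2 * (al + la) * met u v - 2 * (be + mu) * (eta u * eta v).
Proof.
have /eqP := soliton u v; rewrite addr_eq0 ric_eta => /eqP ->; ring.
Qed.

Let dk u : act u k = 0.
Proof. by rewrite /k !actE la_const mu_const; ring. Qed.

(** Cartan's formula L_v eta = d (eta v), as eta is closed. *)
Let lie_eta v u : act v (eta u) - eta (br v u) = act u (eta v).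
Proof. rewrite /br !act_eta !metE (metC G u v); ring. Qed.

Let lie_xi u v : lie_met G xi u v = 2 * (met u v - eta u * eta v).
Proof. rewrite /lie_met !nab_xi !metE (metC G xi v); ring. Qed.

(** W + k xi is the gradient of f. *)
Let df u : act u f = met W u + k * eta u.
Proof.
have := lieV u xi; rewrite /lie_met xi_unit eta_einstein_sum => h.
rewrite /f act_met nab_xi /W /br nab_xi !metE (metC G xi u) /k /f.
rewrite (metC G (nab xi V) u).
have -> : eta (nab u V) =  - 2 * (- (2 * n)%:R - be + la) * eta u -
    2 * (be + mu) * (eta u * 1) - met u (nab xi V) by rewrite -h addrK.
ring.
Qed.

(** W is the difference of a gradient and of k xi, both of which have a symmetric
    covariant derivative. *)
Let nabW_sym u v : met (nab u W) v = met u (nab v W).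
Proof.
have e1 a b : met (nab a W) b = act a (met W b) - met W (nab a b).
  by rewrite act_met; ring.
rewrite (metC G u) !e1.
have wE a : met W a = act a f - k * eta a by rewrite df; ring.
have := act_br G u v f; rewrite !actE => h.
rewrite !wE !actE !actM !dk (act_eta u v) (act_eta v u) (metC G v u).
apply/eqP; rewrite -subr_eq0; apply/eqP.
rewrite -[RHS](subrr (act u (act v f) - act v (act u f))) -{2}h; ring.
Qed.

Let q := k + 2 * be.

(** Since nab W is symmetric, it is half of L_W g = L_[V, xi] g + k L_xi g, and
    lie_met_br expresses L_[V, xi] g through L_V g and L_xi g. *)
Let met_nabW u v : met (nab u W) v =
  q * (met u v - eta u * eta v) - met W u * eta v - eta u * met W v.
Proof.
apply/eqP; rewrite -subr_eq0; apply/eqP/(@regular 1).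
have h : lie_met G W u v = lie_met G (br V xi) u v + k * lie_met G xi u v.
  by rewrite /lie_met /W !nabE !dk !scale0r !add0r !metE; ring.
have hW : lie_met G W u v = met (nab u W) v *+ 2.
  by rewrite /lie_met -nabW_sym; ring.
have aV a b : act V (met a b) = - 2 * (al + la) * met a b
    - 2 * (be + mu) * (eta a * eta b) + met (br V a) b + met a (br V b).
  by rewrite -lieV lie_metE; ring.
have aVe a : act V (eta a) = met W a + k * eta a + eta (br V a).
  by rewrite -df -[act a f]lie_eta; ring.
have ax a b : act xi (met a b) =
    2 * (met a b - eta a * eta b) + met (br xi a) b + met a (br xi b).
  by rewrite -lie_xi lie_metE; ring.
have axe a : act xi (eta a) = eta (br xi a).
  by have := lie_eta xi a; rewrite xi_unit act1 => /eqP; rewrite subr_eq0 => /eqP.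
have two a : act a 2 = 0 by rewrite act_nat.
(* aV, aVe, ax and axe remove every derivative along V or xi of metric
   products, leaving a polynomial identity. *)
rewrite mulrnBl -hW h lie_met_br !lie_xi !lieV.
rewrite !(actE, actM, two) ?la_const ?mu_const !aVe !axe !aV !ax.
rewrite !schur_eta xi_unit.
have -> : act xi al = 2 * be.
  by rewrite eta_einstein_sum !actE schur_eta xi_unit; ring.
rewrite /q /k eta_einstein_sum; ring.
Qed.

Let met_Wxi : met W xi = 0.
Proof.
apply: (@regular 1).
have h1 : act xi f *+ 2 = k *+ 2.
  have := lieV xi xi; rewrite /lie_met xi_unit (metC G xi) eta_einstein_sum => h.
  rewrite /f act_met nab_xi xi_unit scale1r subrr met0r addr0.
  by rewrite [LHS]mulr2n h /k; ring.
by have := h1; rewrite df xi_unit mulr1 mulrnDl => /(canRL (addrK _)) ->; rewrite subrr.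
Qed.

(** The trace left by the soliton on the geometry: a field whose derivative is
    prescribed, and which beta_eq0_of_field shows to be too rigid unless beta
    vanishes. *)
Lemma soliton_field : exists Z : X, met Z xi = 0 /\
  forall u, nab u Z = (k + 2 * be) *: (u - eta u *: xi) - met Z u *: xi - eta u *: Z.
Proof.
move: met_Wxi met_nabW; rewrite /q; move: W => Z Zxi nabZ.
exists Z; split=> // u; apply: (@met_inj _ _ _ G) => v.
by rewrite nabZ !metE (metC G xi); ring.
Qed.

Section Field.
Variable Z : X.
Hypothesis met_Zxi : met Z xi = 0.
Hypothesis nabZ : forall u,
  nab u Z = (k + 2 * be) *: (u - eta u *: xi) - met Z u *: xi - eta u *: Z.

Let curvZ u v : curv G u v Z =
  (2 * k) *: (eta u *: v - eta v *: u) + met Z u *: v - met Z v *: u.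
Proof.
have dq a : act a (k + 2 * be) = - 4 * be * eta a.
  by rewrite actD actM dk act_nat schur_eta; ring.
have aZ a b : act a (met Z b) = (k + 2 * be) * (met a b - eta a * eta b)
    - met Z a * eta b - eta a * met Z b + met Z (nab a b).
  by rewrite act_met nabZ !metE (metC G xi b); ring.
apply: (@met_inj _ _ _ G) => w; rewrite /curv !nabZ /br.
rewrite !nabE !nab_xi !nabZ !act_eta !aZ !dq !metE (metC G v u); ring.
Qed.

(** The trace of curvZ gives Ric(a, Z), to be compared with its eta-Einstein
    expression. *)
Let be_Z_k a : be * met Z a = 4 * n%:R * k * eta a.
Proof.
have m_lin z c b b' : met (c *: b + b') z = c * met b z + met b' z by rewrite !metE.
have Z_lin c b b' : met Z (c *: b + b') = c * met Z b + met Z b' by rewrite !metE.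
have ricZ : ric G a Z = - (4 * n%:R * k * eta a) - 2 * n%:R * met Z a.
  transitivity (\sum_i ((2 * k) * (eta (e i) * met a (e' i)
    - eta a * met (e i) (e' i))
    + met Z (e i) * met a (e' i) - met Z a * met (e i) (e' i))).
    by apply: eq_bigr => i _; rewrite /curv4 curvZ !metE; ring.
  rewrite !sumrB big_split -!mulr_sumr sumrB -mulr_sumr /=.
  rewrite (trace_prod G a (m_lin xi)) (trace_prod G a Z_lin) trace_met.
  rewrite -[(2 * n).+1%:R]natr1 natrM; ring.
have := ricZ; rewrite ric_eta met_Zxi eta_einstein_sum (metC G a Z) natrM.
move=> /eqP; rewrite -subr_eq0 => /eqP h.
by apply/eqP; rewrite -subr_eq0 -oppr_eq0 -h; apply/eqP; ring.
Qed.

(** Z is orthogonal to xi, so the left-hand side of be_Z_k vanishes at xi. *)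
Let k_eq0 : k = 0.
Proof.
apply: (@regular (4 * n).-1); rewrite prednK ?muln_gt0 ?(ltnW n_gt1) //.
have := be_Z_k xi; rewrite met_Zxi mulr0 xi_unit mulr1.
by rewrite -[X in _ -> X = _]mulr_natl natrM.
Qed.

Let be_Z a : be * met Z a = 0.
Proof. by rewrite be_Z_k k_eq0 mulr0 mul0r. Qed.

(** Since beta Z = 0, also beta ^ 2 nab Z = 0. In nabZ only the term
    2 beta (u - eta u xi) survives multiplication by beta ^ 2, and its trace is
    4 n beta. *)
Lemma beta_eq0_of_field : be = 0.
Proof.
have bbZ u v : be * be * met (nab u Z) v = 0.
  have := act0 G u; rewrite -(be_Z v) actM act_met schur_eta => h.
  have bz := be_Z v; have bz' := be_Z (nab u v).
  transitivity (be * (- 2 * be * eta u * met Z v + be * (met (nab u Z) v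
    + met Z (nab u v))) + 2 * be * eta u * (be * met Z v)
    - be * (be * met Z (nab u v))); first by ring.
  by rewrite h bz bz' !mulr0 addr0 subr0.
have be3 : be * be * be *+ (4 * n) = 0.
  transitivity (\sum_i be * be * met (nab (e i) Z) (e' i)); last first.
    by apply: big1 => i _; exact: bbZ.
  transitivity (\sum_i (be * be * (2 * be)) * (met (e i) (e' i)
    - eta (e i) * eta (e' i))); last first.
    apply: eq_bigr => i _; rewrite nabZ !metE k_eq0 (metC G xi).
    transitivity (be * be * (2 * be) * (met (e i) (e' i) - eta (e i) * eta (e' i))
      - be * (be * met Z (e i)) * eta (e' i)
      - eta (e i) * be * (be * met Z (e' i))); last by ring.
    by rewrite !be_Z; ring.
  rewrite -mulr_sumr sumrB trace_met.
  have -> : \sum_i eta (e i) * eta (e' i) = 1.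
    rewrite (trace_eta (l := fun u => eta u)) ?xi_unit // => *.
    by rewrite !metE.
  rewrite -[(2 * n).+1%:R]natr1 addrK -[LHS]mulr_natr !natrM; ring.
have be3' : be * be * be = 0.
  by apply: (@regular (4 * n).-1); rewrite prednK ?muln_gt0 ?(ltnW n_gt1).
by apply/reduced/reduced; rewrite mulrA be3' mul0r.
Qed.
End Field.

Theorem beta_eq0 : be = 0.
Proof.
by have [Z [Zxi nabZ]] := soliton_field; exact: (beta_eq0_of_field Zxi nabZ).
Qed.

End Soliton.
End Kenmotsu.

(** * Closure properties of smooth functions *)

Section Smooth.
Local Open Scope classical_set_scope.
Local Open Scope ring_scope.
Variables (R : realType) (V : normedModType R) (U : set V).
Hypothesis U_open : open U.
Implicit Types (W : normedModType R) (k : nat) (x v : V).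

Lemma near_open x : U x -> \forall y \near x, U y.
Proof. by move=> Ux; exact: open_nbhs_nbhs. Qed.

Lemma near_eq_open W (f g : V -> W) x :
  (forall y, U y -> f y = g y) -> U x -> \near x, f x = g x.
Proof.
by move=> fg Ux; near do apply: fg; exact: near_open.
Unshelve. all: by end_near. Qed.

(** The candidate differential of g is that of f, and the error terms of the two
    functions agree near x. *)
Lemma near_eq_differentiable W (f g : V -> W) x :
  (\near x, f x = g x) -> differentiable f x -> differentiable g x.
Proof.
move=> fg df; have fgx : f x = g x := nbhs_singleton fg.
have dg : g \o shift x = cst (g x) + 'd f x +o_ 0 id.
  apply/eqaddoP => e e0.
  have := diff_locally df => /eqaddoP/(_ e e0) fo.
  have fg0 : \forall h \near 0, f (h + x) = g (h + x).
    by move: fg; rewrite (near_shift 0 x) /=; apply: filterS => h; rewrite subr0.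
  near=> h.
  have -> : (g \o shift x - (cst (g x) + 'd f x)) h
    = (f \o shift x - (cst (f x) + 'd f x)) h.
    by rewrite !fctE /= -fgx (near fg0).
  near: h; exact: fo.
have dfg : 'd g x = 'd f x :> (V -> W).
  by apply: diff_unique => //; exact: diff_continuous.
apply/diff_locallyP; rewrite dfg; split => //; exact: diff_continuous.
Unshelve. all: by end_near. Qed.

Lemma derive_eq_open W (f g : V -> W) x v :
  (forall y, U y -> f y = g y) -> U x -> 'D_v f x = 'D_v g x.
Proof. by move=> fg Ux; apply: near_eq_derive; exact: near_eq_open. Qed.

Lemma Ck_on_ext W k (f g : V -> W) :
  (forall x, U x -> f x = g x) -> Ck_on k U f -> Ck_on k U g.
Proof.
elim: k f g => [|k IH] f g fg /=.
  move=> cf x Ux; have := cf x Ux; rewrite /prop_for /continuous_at -(fg x Ux) => h.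
  by apply: cvg_trans h; apply: near_eq_cvg; exact: near_eq_open.
move=> [df Df]; split=> [x Ux|v].
  by apply: near_eq_differentiable (df x Ux); exact: near_eq_open.
by apply: IH (Df v) => x Ux; exact: derive_eq_open.
Qed.

Lemma Ck_on_pred W k (f : V -> W) : Ck_on k.+1 U f -> Ck_on k U f.
Proof.
elim: k f => [|k IH] f /= [df Df].
  by move=> x Ux; apply: differentiable_continuous; exact: df.
by split=> // v; apply: IH; exact: Df.
Qed.

Lemma Ck_on_cst W k (w : W) : Ck_on k U (cst w).
Proof.
elim: k w => [|k IH] w /=; first by move=> x _; exact: cst_continuous.
split=> [x _|v]; first exact: differentiable_cst.
by apply: (@Ck_on_ext _ _ (cst 0)) => // x _; rewrite derive_cst.
Qed.

Lemma Ck_onD W k (f g : V -> W) :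
  Ck_on k U f -> Ck_on k U g -> Ck_on k U (fun x => f x + g x).
Proof.
elim: k f g => [|k IH] f g /=.
  by move=> cf cg x Ux; apply: continuousD; [exact: cf|exact: cg].
move=> [df Df] [dg Dg]; split=> [x Ux|v].
  by apply: differentiableD; [exact: df|exact: dg].
apply: Ck_on_ext (IH _ _ (Df v) (Dg v)) => x Ux.
by rewrite deriveD //; apply: diff_derivable; [exact: df|exact: dg].
Qed.

Lemma Ck_on_linear (W W' : normedModType R) k (L : {linear W -> W'}) (f : V -> W) :
  continuous L -> Ck_on k U f -> Ck_on k U (L \o f).
Proof.
move=> cL; elim: k f => [|k IH] f /=.
  by move=> cf x Ux; apply: continuous_comp; [exact: cf|exact: cL].
move=> [df Df]; have dL w : differentiable L w by exact: linear_differentiable.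
split=> [x Ux|v]; first by apply: differentiable_comp; [exact: df|exact: dL].
apply: Ck_on_ext (IH _ (Df v)) => x Ux /=.
have dfx := df x Ux; have dLf : differentiable (L \o f) x by exact: differentiable_comp.
by rewrite !deriveE // (diff_comp dfx (dL _)) /= (diff_lin (f x) cL).
Qed.

Lemma Ck_onM k (f g : V -> R) :
  Ck_on k U f -> Ck_on k U g -> Ck_on k U (fun x => f x * g x).
Proof.
elim: k f g => [|k IH] f g.
  by move=> /= cf cg x Ux; apply: continuousM; [exact: cf|exact: cg].
move=> cf cg; have [df Df] := cf; have [dg Dg] := cg; split=> [x Ux|v].
  by apply: differentiableM; [exact: df|exact: dg].
apply: Ck_on_ext (Ck_onD (IH _ _ (Ck_on_pred cf) (Dg v))
  (IH _ _ (Ck_on_pred cg) (Df v))) => x Ux.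
by rewrite deriveM //; apply: diff_derivable; [exact: df|exact: dg].
Qed.

(** By induction on k, the derivative of 1/f is the product of - D f with two
    copies of 1/f, which is already known to be of class C^k. *)
Lemma Ck_onV k (f : V -> R) : (forall x, U x -> f x != 0) ->
  Ck_on k U f -> Ck_on k U (fun x => (f x)^-1).
Proof.
move=> f0; elim: k => [|k IH].
  by move=> /= cf x Ux; apply: cvgV; [exact: f0|exact: cf].
move=> cf; have [df Df] := cf; have cV := IH (Ck_on_pred cf).
split=> [x Ux|v]; first by apply: differentiableV; [exact: df|exact: f0].
have cN := Ck_onM (@Ck_on_cst R^o k (-1)) (Df v).
apply: Ck_on_ext (Ck_onM (Ck_onM cV cV) cN) => x Ux.
rewrite deriveV ?f0 //; last by apply: diff_derivable; exact: df.
by rewrite /GRing.scale /= -exprVn; ring.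
Qed.

End Smooth.

(** * Symmetry of second derivatives *)

Section Schwarz.
Local Open Scope classical_set_scope.
Local Open Scope ring_scope.
Variables (R : realType) (V : normedModType R).
Implicit Types (f : V -> R) (u v x p : V).

Lemma is_derive_line f p u (t : R) : derivable f (p + t *: u) u ->
  is_derive t 1 (fun s => f (p + s *: u)) ('D_u f (p + t *: u)).
Proof.
have E : (fun h : R => h^-1 *: (f (p + (h *: 1 + t) *: u) - f (p + t *: u)))
       = (fun h => h^-1 *: (f (h *: u + (p + t *: u)) - f (p + t *: u))).
  apply/funext => h; congr (_ *: (f _ - _)).
  by rewrite [h *: 1]mulr1 scalerDl addrCA.
move=> df; apply: DeriveDef; first by rewrite /derivable E.
by rewrite /derive E.
Qed.

(** The mean value theorem, applied first in the direction u to the difference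
    of f between two parallel sides, then in the direction v. *)
Lemma second_difference (U : set V) f x u v (s : R) : Ck_on 2 U f -> 0 < s ->
  (forall a b, 0 <= a <= s -> 0 <= b <= s -> U (x + a *: u + b *: v)) ->
  exists a b, [/\ 0 <= a <= s, 0 <= b <= s &
    f (x + s *: u + s *: v) - f (x + s *: u) - f (x + s *: v) + f x
    = s ^+ 2 * 'D_v (fun y => 'D_u f y) (x + a *: u + b *: v)].
Proof.
move=> [df Df] s0 Us.
have dfu y : U y -> derivable f y u by move=> Uy; exact/diff_derivable/df.
have ds : 0 <= s <= s by apply/andP; split; [exact: ltW|exact: lexx].
have d0 : (0 : R) <= 0 <= s by apply/andP; split; [exact: lexx|exact: ltW].
pose F t := f (x + s *: v + t *: u) - f (x + t *: u).
have Us1 t : 0 <= t <= s -> U (x + s *: v + t *: u).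
  by move=> ht; rewrite addrAC; exact: Us.
have Us0 t : 0 <= t <= s -> U (x + t *: u).
  by move=> ht; have := Us t 0 ht d0; rewrite scale0r addr0.
have dF t : 0 <= t <= s -> is_derive t 1 F
    ('D_u f (x + s *: v + t *: u) - 'D_u f (x + t *: u)).
  move=> ht; apply: is_deriveB; apply: is_derive_line; apply: dfu.
    exact: Us1.
  exact: Us0.
have in0s t : t \in `]0, s[ -> 0 <= t <= s.
  by rewrite in_itv /= => /andP[/ltW -> /ltW ->].
have [|a a0s Fa] := MVT s0 (fun t ht => dF t (in0s t ht)).
  apply: derivable_within_continuous => t; rewrite in_itv /= => ht.
  by have [] := dF t ht.
have ha := in0s a a0s.
pose H t := 'D_u f (x + a *: u + t *: v).
have dH t : 0 <= t <= s -> is_derive t 1 H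
    ('D_v (fun y => 'D_u f y) (x + a *: u + t *: v)).
  move=> ht; apply: is_derive_line; apply: diff_derivable.
  by apply: (Df u).1; exact: Us.
have [|b b0s Hb] := MVT s0 (fun t ht => dH t (in0s t ht)).
  apply: derivable_within_continuous => t; rewrite in_itv /= => ht.
  by have [] := dH t ht.
exists a, b; split; [exact: ha|exact: in0s|].
move: Fa Hb; rewrite /F /H !scale0r !addr0 !subr0 => Fa Hb.
rewrite expr2 -mulrA [s * 'D_v _ _]mulrC -Hb.
rewrite [x + a *: u + s *: v]addrAC mulrC -Fa [x + s *: v + s *: u]addrAC; ring.
Qed.

Lemma near_dist_lt (A : V -> R) x (e : R) : {for x, continuous A} -> 0 < e ->
  \forall y \near x, `|A x - A y| < e.
Proof. by move=> /cvgrPdist_lt cA e0; exact: cA. Qed.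

(** The second difference of f is symmetric in u and v, hence both mixed
    derivatives take the same value at suitable points of an arbitrarily small
    parallelogram at x; both are continuous. *)
Lemma derive_comm (U : set V) f x u v : open U -> smooth_on U f -> U x ->
  'D_v (fun y => 'D_u f y) x = 'D_u (fun y => 'D_v f y) x.
Proof.
move=> oU sf Ux.
have cont a b : {for x, continuous (fun y => 'D_b (fun z => 'D_a f z) y)}.
  by have [_ /(_ a)[_ /(_ b)]] := sf 2; apply.
pose A y := 'D_v (fun z => 'D_u f z) y; pose B y := 'D_u (fun z => 'D_v f z) y.
suff AB : forall e : R, 0 < e -> `|A x - B x| <= e.
  apply/eqP; rewrite -subr_eq0 -normr_le0; apply/ler_addgt0Pr => e e0.
  by rewrite add0r; exact: AB.
move=> e e0; have e2 : 0 < e / 2 by rewrite divr_gt0.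
have nA : \forall y \near x, `|A x - A y| < e / 2.
  exact: near_dist_lt (cont u v) e2.
have nB : \forall y \near x, `|B x - B y| < e / 2.
  exact: near_dist_lt (cont v u) e2.
have nW : \forall y \near x, [/\ U y, `|A x - A y| < e / 2 & `|B x - B y| < e / 2].
  by apply: filterS3 (near_open oU Ux) nA nB => y.
have /nbhs_ballP[r /= r0 rP] := nW.
(* With this s, the parallelogram spanned at x by s u and s v lies in the ball of
   radius r. *)
pose s := r / (`|u| + `|v| + 1).
have n0 : 0 < `|u| + `|v| + 1 by rewrite ltr_wpDl ?addr_ge0.
have s0 : 0 < s by rewrite divr_gt0.
have inball a b : 0 <= a <= s -> 0 <= b <= s -> ball x r (x + a *: u + b *: v).
  move=> /andP[a0 la] /andP[b0 lb]; rewrite -ball_normE /= -addrA opprD addNKr.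
  rewrite normrN (le_lt_trans (ler_normD _ _)) // !normrZ !ger0_norm //.
  have rE : r = s * (`|u| + `|v| + 1) by rewrite /s divfK // gt_eqF.
  rewrite rE !mulrDr mulr1 [ltRHS]addrC ltr_pwDl //.
  by apply: lerD; apply: ler_wpM2r.
have inU a b : 0 <= a <= s -> 0 <= b <= s -> U (x + a *: u + b *: v).
  by move=> ha hb; have [] := rP _ (inball a b ha hb).
have inU' a b : 0 <= a <= s -> 0 <= b <= s -> U (x + a *: v + b *: u).
  by move=> ha hb; rewrite addrAC; exact: inU.
have [a [b [ha hb E1]]] := second_difference (sf 2) s0 inU.
have [c [d [hc hd E2]]] := second_difference (sf 2) s0 inU'.
have [_ nA1 _] := rP _ (inball a b ha hb).
have [_ _ nB1] := rP _ (inball d c hd hc).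
have AB : A (x + a *: u + b *: v) = B (x + c *: v + d *: u).
  apply: (@mulfI _ (s ^+ 2)); first by rewrite expf_neq0 // gt_eqF.
  rewrite -[LHS]E1 -[RHS]E2 [x + s *: v + s *: u]addrAC; ring.
rewrite [x + d *: u + c *: v]addrAC -AB in nB1.
rewrite distrC in nB1; rewrite (splitr e).
exact: le_trans (ler_distD _ _ _) (ltW (ltrD nA1 nB1)).
Qed.
End Schwarz.

(** * Smoothness of matrix-valued functions *)

Section SmoothOn.
Local Open Scope classical_set_scope.
Local Open Scope ring_scope.
Variables (R : realType) (V : normedModType R) (U : set V).
Hypothesis U_open : open U.
Implicit Types (W : normedModType R).

Lemma smooth_on_ext W (f g : V -> W) :
  (forall x, U x -> f x = g x) -> smooth_on U f -> smooth_on U g.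
Proof. by move=> fg sf k; apply: (Ck_on_ext U_open fg); exact: sf. Qed.

Lemma smooth_on_cst W (w : W) : smooth_on U (cst w).
Proof. by move=> k; exact: Ck_on_cst. Qed.

Lemma smooth_onD W (f g : V -> W) :
  smooth_on U f -> smooth_on U g -> smooth_on U (fun x => f x + g x).
Proof. by move=> sf sg k; apply: Ck_onD; [|exact: sf|exact: sg]. Qed.

Lemma smooth_onM (f g : V -> R) :
  smooth_on U f -> smooth_on U g -> smooth_on U (fun x => f x * g x).
Proof. by move=> sf sg k; apply: Ck_onM; [|exact: sf|exact: sg]. Qed.

Lemma smooth_onV (f : V -> R) : (forall x, U x -> f x != 0) ->
  smooth_on U f -> smooth_on U (fun x => (f x)^-1).
Proof. by move=> f0 sf k; apply: Ck_onV => //; exact: sf. Qed.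

Lemma smooth_on_derive W (f : V -> W) v :
  smooth_on U f -> smooth_on U (fun x => 'D_v f x).
Proof. by move=> sf k; have [_ Df] := sf k.+1; exact: Df. Qed.

Lemma smooth_on_linear (W W' : normedModType R) (L : {linear W -> W'}) (f : V -> W) :
  continuous L -> smooth_on U f -> smooth_on U (L \o f).
Proof. by move=> cL sf k; apply: Ck_on_linear => //; exact: sf. Qed.

Lemma smooth_on_differentiable W (f : V -> W) x :
  smooth_on U f -> U x -> differentiable f x.
Proof. by move=> sf Ux; have [df _] := sf 1; exact: df. Qed.

Lemma smooth_on_sum W I (r : seq I) (F : I -> V -> W) :
  (forall i, smooth_on U (F i)) -> smooth_on U (fun x => \sum_(i <- r) F i x).
Proof.
move=> sF; elim: r => [|i r IH].
  by apply: smooth_on_ext (smooth_on_cst 0) => x _; rewrite big_nil.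
by apply: smooth_on_ext (smooth_onD (sF i) IH) => x _; rewrite big_cons.
Qed.

Lemma smooth_on_entry p q (F : V -> 'M[R]_(p, q)) i j :
  smooth_on U F -> smooth_on U (fun x => F x i j).
Proof.
move=> sF; have lin : linear (fun N : 'M[R]_(p, q) => N i j : R).
  by move=> a A B; rewrite !mxE.
pose L : {linear 'M[R]_(p, q) -> R} :=
  HB.pack (fun N : 'M[R]_(p, q) => N i j : R) (GRing.isLinear.Build _ _ _ _ _ lin).
have cL : continuous L by move=> N; exact: coord_continuous.
exact: (smooth_on_linear cL sF).
Qed.

Lemma smooth_on_matrix p q (F : V -> 'M[R]_(p, q)) :
  (forall i j, smooth_on U (fun x => F x i j)) -> smooth_on U F.
Proof.
move=> sF.
have E x : \sum_i \sum_j F x i j *: delta_mx i j = F x by rewrite -matrix_sum_delta.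
apply: smooth_on_ext (fun x _ => E x) _.
apply: smooth_on_sum => i; apply: smooth_on_sum => j.
have lin : linear (fun c : R^o => c *: delta_mx i j : 'M[R]_(p, q)).
  by move=> a b c; rewrite scalerDl scalerA.
pose L : {linear R^o -> 'M[R]_(p, q)} :=
  HB.pack (fun c : R^o => c *: delta_mx i j : 'M[R]_(p, q))
    (GRing.isLinear.Build _ _ _ _ _ lin).
have cL : continuous L by move=> c; exact: scalel_continuous.
exact: (smooth_on_linear cL (sF i j)).
Qed.

End SmoothOn.

(** * The ring of smooth functions on an open set *)

Section SmoothFunctions.
Local Open Scope classical_set_scope.
Local Open Scope ring_scope.
Variables (R : realType) (V : normedModType R) (U : set V).

(** The value outside U is pinned to 0 so that two functions which agree on U
    are equal. *)
Record smooth_fn := SmoothFn {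
  value : V -> R ;
  value_smooth : smooth_on U value ;
  value_out : forall x, ~ U x -> value x = 0 }.

End SmoothFunctions.

Section ScalarRing.
Local Open Scope classical_set_scope.
Local Open Scope ring_scope.
Variables (R : realType) (V : normedModType R) (U : set V) (U_open : open U).

(** The proof that U is open is a parameter of the type, because the ring
    structure depends on it: smoothness is local, hence stable under products
    and restrictions, only on an open set. *)
Definition smooth_scalar := let _ := U_open in smooth_fn U.
HB.instance Definition _ := gen_eqMixin smooth_scalar.
HB.instance Definition _ := gen_choiceMixin smooth_scalar.
Local Notation S := smooth_scalar.
Local Notation val f x := (value (f : smooth_fn U) x).

Lemma scalar_eq (f g : S) : (forall x, U x -> val f x = val g x) -> f = g.
Proof.
case: f g => [f sf f0] [g sg g0] /= fg.
have E : f = g.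
  apply/funext => x; have [Ux|nUx] := pselect (U x); first exact: fg.
  by rewrite f0 // g0.
by rewrite E in sf f0 *; congr SmoothFn; exact: Prop_irrelevance.
Qed.

Definition extend0 (f : V -> R) : V -> R := fun x => if pselect (U x) then f x else 0.

Lemma extend0E f x : U x -> extend0 f x = f x.
Proof. by rewrite /extend0; case: pselect. Qed.

Lemma extend0_out f x : ~ U x -> extend0 f x = 0.
Proof. by rewrite /extend0; case: pselect. Qed.

Lemma extend0_smooth f : smooth_on U f -> smooth_on U (extend0 f).
Proof. by apply: smooth_on_ext => // x Ux; rewrite extend0E. Qed.

Definition scalar_of f (sf : smooth_on U f) : S :=
  SmoothFn (extend0_smooth sf) (@extend0_out f).

(** The inclusion of functions in the ring is made total, which spares proofs of
    smoothness inside formulas; it is known only through as_scalarE, so that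
    ring elements are compared as such and not as functions. *)
Fact as_scalar_key : {r : (V -> R) -> S |
  forall f x, smooth_on U f -> U x -> val (r f) x = f x}.
Proof.
exists (fun f => if pselect (smooth_on U f) is left sf then scalar_of sf
  else scalar_of (smooth_on_cst U_open (0 : R^o))).
by move=> f x sf Ux; case: pselect => //= ?; rewrite extend0E.
Qed.

Definition as_scalar : (V -> R) -> S := sval as_scalar_key.

Lemma as_scalarE f x : smooth_on U f -> U x -> val (as_scalar f) x = f x.
Proof. exact: (svalP as_scalar_key). Qed.

Lemma val_smooth (f : S) : smooth_on U (value f).
Proof. exact: value_smooth. Qed.

Definition add_scalar (f g : S) : S := as_scalar (fun x => val f x + val g x).
Definition mul_scalar (f g : S) : S := as_scalar (fun x => val f x * val g x).
Definition opp_scalar (f : S) : S := as_scalar (fun x => -1 * val f x).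
Definition const_scalar (c : R) : S := as_scalar (cst c).

Let constE c x : U x -> val (const_scalar c) x = c.
Proof. by move=> Ux; rewrite as_scalarE //; exact: (smooth_on_cst _ (c : R^o)). Qed.
Let addE (f g : S) x : U x -> val (add_scalar f g) x = val f x + val g x.
Proof.
by move=> Ux; rewrite as_scalarE //; apply: smooth_onD => //; exact: val_smooth.
Qed.
Let mulE (f g : S) x : U x -> val (mul_scalar f g) x = val f x * val g x.
Proof.
by move=> Ux; rewrite as_scalarE //; apply: smooth_onM => //; exact: val_smooth.
Qed.
Let oppE (f : S) x : U x -> val (opp_scalar f) x = - val f x.
Proof.
move=> Ux; rewrite as_scalarE ?mulN1r //; apply: smooth_onM => //.
  exact: (smooth_on_cst _ (-1 : R^o)).
exact: val_smooth.
Qed.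

Let addA : associative add_scalar.
Proof. by move=> f g h; apply: scalar_eq => x Ux; rewrite !addE // addrA. Qed.
Let addC : commutative add_scalar.
Proof. by move=> f g; apply: scalar_eq => x Ux; rewrite !addE // addrC. Qed.
Let add0 : left_id (const_scalar 0) add_scalar.
Proof. by move=> f; apply: scalar_eq => x Ux; rewrite addE // constE // add0r. Qed.
Let addN : left_inverse (const_scalar 0) opp_scalar add_scalar.
Proof.
by move=> f; apply: scalar_eq => x Ux; rewrite addE // constE // oppE // addNr.
Qed.
HB.instance Definition _ := GRing.isZmodule.Build smooth_scalar addA addC add0 addN.

Let mulA : associative mul_scalar.
Proof. by move=> f g h; apply: scalar_eq => x Ux; rewrite !mulE // mulrA. Qed.
Let mulC : commutative mul_scalar.
Proof. by move=> f g; apply: scalar_eq => x Ux; rewrite !mulE // mulrC. Qed.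
Let mul1 : left_id (const_scalar 1) mul_scalar.
Proof. by move=> f; apply: scalar_eq => x Ux; rewrite mulE // constE // mul1r. Qed.
Let mulD : left_distributive mul_scalar add_scalar.
Proof.
move=> f g h; apply: scalar_eq => x Ux.
by rewrite mulE // !addE // !mulE // mulrDl.
Qed.
HB.instance Definition _ :=
  GRing.Zmodule_isComPzRing.Build smooth_scalar mulA mulC mul1 mulD.

Section Eval.
Variables (x : V) (Ux : U x).
(** Evaluation at a point of U; the proof of membership is what makes it a ring
    morphism, as the unit of the ring is the indicator function of U. *)
Definition ev (f : smooth_scalar) : R := let _ := Ux in val f x.

Let evB : {morph ev : f g / f - g}.
Proof. by move=> f g; rewrite /ev addE // oppE. Qed.
Let evM : multiplicative ev.
Proof. by split=> [f g|]; rewrite /ev ?mulE // constE. Qed.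
HB.instance Definition _ := GRing.isAdditive.Build smooth_scalar R ev evB.
HB.instance Definition _ := GRing.isMultiplicative.Build smooth_scalar R ev evM.
End Eval.

End ScalarRing.

(** * Vector fields as row vectors over the ring of smooth functions *)

Section Chart.
Local Open Scope classical_set_scope.
Local Open Scope ring_scope.
Variables (R : realType) (m : nat) (U : set 'rV[R]_m) (U_open : open U).
Local Notation S := (smooth_scalar U_open).
Local Notation val f := (value (f : smooth_fn U)).
Local Notation ev := (@ev _ _ _ U_open _).

Lemma ev_inj (f g : S) : (forall x (Ux : U x), ev Ux f = ev Ux g) -> f = g.
Proof. by move=> fg; apply: scalar_eq => x Ux; exact: (fg x Ux). Qed.

Lemma scalar_regular k (f : S) : f *+ k.+1 = 0 -> f = 0.
Proof.
move=> fk; apply: ev_inj => x Ux; have := congr1 (ev Ux) fk.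
by rewrite raddfMn raddf0 => /eqP; rewrite mulrn_eq0 /= => /eqP.
Qed.

Lemma scalar_reduced (f : S) : f * f = 0 -> f = 0.
Proof.
move=> ff; apply: ev_inj => x Ux; have := congr1 (ev Ux) ff.
by rewrite rmorphM raddf0 => /eqP; rewrite mulf_eq0 orbb => /eqP.
Qed.

(** Known only through its values on U, for the same reason as as_scalar. *)
Fact partial_key : {D : 'I_m -> S -> S | forall i (f : S) x (Ux : U x),
  ev Ux (D i f) = 'D_(delta_mx 0 i) (val f) x}.
Proof.
exists (fun i f => as_scalar U_open (fun x => 'D_(delta_mx 0 i) (val f) x)).
by move=> i f x Ux; rewrite /ev as_scalarE //; apply/smooth_on_derive/val_smooth.
Qed.

Definition partial : 'I_m -> S -> S := sval partial_key.

Lemma ev_partial x (Ux : U x) i (f : S) :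
  ev Ux (partial i f) = 'D_(delta_mx 0 i) (val f) x.
Proof. exact: (svalP partial_key). Qed.

Lemma val_diff (f : S) x : U x -> differentiable (val f) x.
Proof. by move=> Ux; apply: smooth_on_differentiable Ux; exact: val_smooth. Qed.

Lemma ev_as_scalar x (Ux : U x) f : smooth_on U f ->
  ev Ux (as_scalar U_open f) = f x.
Proof. by move=> sf; rewrite /ev as_scalarE. Qed.

Lemma partialD i (f h : S) : partial i (f + h) = partial i f + partial i h.
Proof.
apply: ev_inj => x Ux; rewrite rmorphD /= !ev_partial.
rewrite -deriveD; [|exact/diff_derivable/val_diff..].
by apply: (derive_eq_open U_open) => // y Uy; exact: (rmorphD (ev Uy)).
Qed.

Lemma partialM i (f h : S) : partial i (f * h) = partial i f * h + f * partial i h.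
Proof.
apply: ev_inj => x Ux; rewrite rmorphD !rmorphM /= !ev_partial.
transitivity ('D_(delta_mx 0 i) (val f * val h) x).
  by apply: (derive_eq_open U_open) => // y Uy; exact: (rmorphM (ev Uy)).
rewrite deriveM; [|exact/diff_derivable/val_diff..].
by rewrite addrC /GRing.scale /= [_ * val h x]mulrC mulrC [X in X + _]mulrC.
Qed.

Lemma partialC i j (f : S) : partial i (partial j f) = partial j (partial i f).
Proof.
apply: ev_inj => x Ux.
rewrite ev_partial.
rewrite ev_partial.
have E a : forall y, U y -> val (partial a f) y = 'D_(delta_mx 0 a) (val f) y.
  by move=> y Uy; exact: (ev_partial Uy).
transitivity ('D_(delta_mx 0 i) (fun y => 'D_(delta_mx 0 j) (val f) y) x).
  exact: (derive_eq_open U_open _ (E j) Ux).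
transitivity ('D_(delta_mx 0 j) (fun y => 'D_(delta_mx 0 i) (val f) y) x).
  exact: (derive_comm _ _ U_open (@val_smooth _ _ _ U_open f) Ux).
exact: esym (derive_eq_open U_open _ (E i) Ux).
Qed.

Lemma partial_const i c : partial i (const_scalar U_open c) = 0.
Proof.
apply: ev_inj => x Ux; rewrite ev_partial rmorph0.
rewrite (derive_eq_open U_open (g := cst c)) ?derive_cst // => y Uy.
by rewrite /const_scalar as_scalarE //; exact: (smooth_on_cst _ (c : R^o)).
Qed.

(** Matrices over the ring of smooth functions are the same as smooth functions
    with values in matrices; realize and lift_mx go from one to the other. *)
Definition realize p q (A : 'M[S]_(p, q)) : 'rV[R]_m -> 'M[R]_(p, q) :=
  fun x => \matrix_(i, j) val (A i j) x.

Definition lift_mx p q (F : 'rV[R]_m -> 'M[R]_(p, q)) : 'M[S]_(p, q) :=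
  \matrix_(i, j) as_scalar U_open (fun x => F x i j).

Lemma realizeE p q (A : 'M[S]_(p, q)) x (Ux : U x) :
  realize A x = map_mx (ev Ux) A.
Proof. by apply/matrixP => i j; rewrite !mxE. Qed.

Lemma realize_inj p q (A B : 'M[S]_(p, q)) :
  (forall x, U x -> realize A x = realize B x) -> A = B.
Proof.
move=> AB; apply/matrixP => i j; apply: ev_inj => x Ux.
by have /matrixP/(_ i j) := AB x Ux; rewrite !mxE.
Qed.

Lemma realize_smooth p q (A : 'M[S]_(p, q)) : smooth_on U (realize A).
Proof.
apply: smooth_on_matrix => // i j; apply: smooth_on_ext (val_smooth (A i j)) => //.
by move=> x _; rewrite mxE.
Qed.

Lemma realize_lift p q (F : 'rV[R]_m -> 'M[R]_(p, q)) x :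
  smooth_on U F -> U x -> realize (lift_mx F) x = F x.
Proof.
move=> sF Ux; apply/matrixP => i j; rewrite !mxE as_scalarE //.
exact: smooth_on_entry.
Qed.

Definition act_scalar (X : 'rV[S]_m) (f : S) : S := \sum_i X 0 i * partial i f.
Definition act_mx p q (X : 'rV[S]_m) (A : 'M[S]_(p, q)) := map_mx (act_scalar X) A.

Lemma ev_act x (Ux : U x) X f :
  ev Ux (act_scalar X f) = 'D_(realize X x) (val f) x.
Proof.
rewrite rmorph_sum deriveE; last exact: val_diff.
rewrite (row_sum_delta (realize X x)) linear_sum; apply: eq_bigr => i _.
rewrite linearZ rmorphM /= ev_partial deriveE; last exact: val_diff.
by rewrite mxE.
Qed.

Lemma realize_act p q x (Ux : U x) X (A : 'M[S]_(p, q)) :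
  realize (act_mx X A) x = 'D_(realize X x) (realize A) x.
Proof.
rewrite derive_mx; last first.
  by apply/diff_derivable/(smooth_on_differentiable (@realize_smooth _ _ _)).
apply/matrixP => i j; rewrite !mxE.
transitivity (ev Ux (act_scalar X (A i j))) => //.
rewrite ev_act; apply: (derive_eq_open U_open) => // y _; by rewrite mxE.
Qed.

Lemma act_scalarD X f h : act_scalar X (f + h) = act_scalar X f + act_scalar X h.
Proof. by rewrite -big_split; apply: eq_bigr => i _; rewrite partialD mulrDr. Qed.
Lemma act_scalarM X f h :
  act_scalar X (f * h) = act_scalar X f * h + f * act_scalar X h.
Proof.
rewrite mulr_suml mulr_sumr -big_split; apply: eq_bigr => i _.
by rewrite partialM /=; ring.
Qed.
Lemma act_scalar_lin f X Y h :
  act_scalar (f *: X + Y) h = f * act_scalar X h + act_scalar Y h.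
Proof.
by rewrite mulr_sumr -big_split; apply: eq_bigr => i _; rewrite !mxE /=; ring.
Qed.
Lemma act_scalar_const X c : act_scalar X (const_scalar U_open c) = 0.
Proof. by apply: big1 => i _; rewrite partial_const mulr0. Qed.

Lemma act_scalarB X f h : act_scalar X (f - h) = act_scalar X f - act_scalar X h.
Proof. by apply/eqP; rewrite eq_sym subr_eq -act_scalarD subrK. Qed.
Lemma act_scalar0 X : act_scalar X 0 = 0.
Proof. by have := act_scalarB X 0 0; rewrite subr0 subrr. Qed.
Lemma act_scalar_sum X I (r : seq I) (F : I -> S) :
  act_scalar X (\sum_(i <- r) F i) = \sum_(i <- r) act_scalar X (F i).
Proof. exact: (big_morph _ (act_scalarD X) (act_scalar0 X)). Qed.

(** The Lie bracket, as the torsion-free bracket of the flat connection. *)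
Definition flat_br (X Y : 'rV[S]_m) := act_mx X Y - act_mx Y X.

Lemma act_flat_br X Y f : act_scalar (flat_br X Y) f =
  act_scalar X (act_scalar Y f) - act_scalar Y (act_scalar X f).
Proof.
have E A B : act_scalar A (act_scalar B f) = \sum_i act_scalar A (B 0 i) * partial i f
    + \sum_i \sum_j A 0 i * B 0 j * partial i (partial j f).
  rewrite [act_scalar B f]/act_scalar act_scalar_sum.
  under eq_bigr do rewrite act_scalarM; rewrite big_split; congr (_ + _).
  under eq_bigr do rewrite mulr_sumr; rewrite exchange_big.
  by apply: eq_bigr => i _; apply: eq_bigr => j _; rewrite mulrCA mulrA.
rewrite !E [X in _ = _ - (_ + X)]exchange_big opprD addrACA -!sumrB.
rewrite [X in _ = _ + X]big1 ?addr0 => [|i _]; last first.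
  by rewrite -sumrB big1 // => j _; rewrite partialC [Y 0 j * _]mulrC subrr.
by apply: eq_bigr => i _; rewrite !mxE mulrBl.
Qed.

Lemma flat_jacobi X Y Z : flat_br X (flat_br Y Z) + flat_br Y (flat_br Z X)
  + flat_br Z (flat_br X Y) = 0.
Proof.
apply/rowP => i; rewrite !mxE !act_flat_br !act_scalarB; ring.
Qed.

End Chart.

(** * The Levi-Civita calculus of a metric *)

Section LocalMetric.
Local Open Scope classical_set_scope.
Local Open Scope ring_scope.
Variables (R : realType) (m : nat) (U : set 'rV[R]_m) (U_open : open U).
Local Notation S := (smooth_scalar U_open).
Local Notation val f := (value (f : smooth_fn U)).
Local Notation ev := (@ev _ _ _ U_open _).
Variable g : 'rV[R]_m -> 'M[R]_m.
Hypothesis g_smooth : smooth_on U g.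
Hypothesis g_inner : forall x, U x -> inner_product (g x).

Lemma inner_product_unitmx (B : 'M[R]_m) : inner_product B -> B \in unitmx.
Proof.
move=> [_ Bpos]; rewrite -row_free_unit; apply/row_freeP.
suff : kermx B == 0 by rewrite kermx_eq0 => /row_freeP.
apply/eqP/row_matrixP => i; rewrite row0; apply/eqP/negPn/negP => v0.
have := Bpos _ v0; rewrite /bilin.
by rewrite (sub_kermxP (row_sub i (kermx B))) mul0mx mxE ltxx.
Qed.

Lemma bilin_delta (B : 'M[R]_m) i j : bilin B (delta_mx 0 i) (delta_mx 0 j) = B i j.
Proof. by rewrite /bilin -rowE trmx_delta -colE !mxE. Qed.

Lemma bilinE (B : 'M[R]_m) u v : bilin B u v = \sum_i \sum_j u 0 i * v 0 j * B i j.
Proof.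
rewrite /bilin mxE exchange_big; apply: eq_bigr => j _ /=; rewrite !mxE mulr_suml.
by apply: eq_bigr => i _; rewrite mulrAC.
Qed.

Lemma inner_product_tr (B : 'M[R]_m) : inner_product B -> B^T = B.
Proof.
by move=> [Bs _]; apply/matrixP => i j; rewrite mxE -!bilin_delta Bs.
Qed.

Local Notation gS := (lift_mx U_open g).

Lemma realize_metric x : U x -> realize gS x = g x.
Proof. exact: realize_lift. Qed.

Lemma ev_metric x (Ux : U x) i j : ev Ux (gS i j) = g x i j.
Proof. by have /matrixP/(_ i j) := realize_metric Ux; rewrite mxE. Qed.

Lemma det_realize x (Ux : U x) : ev Ux (\det gS) = \det (g x).
Proof. by rewrite -det_map_mx -realizeE realize_metric. Qed.

Lemma det_smooth : smooth_on U (fun x => \det (g x)).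
Proof.
apply: smooth_on_ext (val_smooth (\det gS)) => // x Ux; exact: det_realize.
Qed.

Lemma det_neq0 x : U x -> \det (g x) != 0.
Proof. by move=> Ux; rewrite -unitfE -unitmxE; apply/inner_product_unitmx/g_inner. Qed.

(** The inverse metric has smooth entries because it is given by Cramer's
    formula. *)
Definition inv_metric : 'M[S]_m :=
  as_scalar U_open (fun x => (\det (g x))^-1) *: \adj gS.

Lemma mul_inv_metric : gS *m inv_metric = 1%:M.
Proof.
rewrite -scalemxAr mul_mx_adj scale_scalar_mx; congr (_%:M).
apply: ev_inj => x Ux.
rewrite rmorphM rmorph1 /= det_realize ev_as_scalar ?mulVf ?det_neq0 //.
by apply: smooth_onV => // [y|]; [exact: det_neq0|exact: det_smooth].
Qed.

Lemma metric_tr : gS^T = gS.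
Proof.
apply: realize_inj => x Ux; rewrite realizeE -map_trmx -realizeE.
by rewrite realize_metric // inner_product_tr //; exact: g_inner.
Qed.

Lemma inv_metric_tr : inv_metric^T = inv_metric.
Proof.
have h : inv_metric^T *m gS = 1%:M.
  by rewrite -{1}metric_tr -trmx_mul mul_inv_metric trmx1.
by rewrite -[LHS]mulmx1 -mul_inv_metric mulmxA h mul1mx.
Qed.

Lemma realize_inv_metric x : U x -> realize inv_metric x = invmx (g x).
Proof.
move=> Ux; have gu := inner_product_unitmx (g_inner Ux).
rewrite -[LHS]mul1mx -(mulVmx gu) -mulmxA -{2}(realize_metric Ux).
by rewrite !(realizeE _ Ux) -map_mxM mul_inv_metric map_mx1 mulmx1.
Qed.

Definition met_field (X Y : 'rV[S]_m) : S := (X *m gS *m Y^T) 0 0.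

Lemma ev_met x (Ux : U x) X Y :
  ev Ux (met_field X Y) = metric g (realize X) (realize Y) x.
Proof.
rewrite /metric /bilin -{1}(realize_metric Ux) !(realizeE _ Ux) map_trmx -!map_mxM.
by rewrite mxE.
Qed.

Lemma met_fieldC X Y : met_field X Y = met_field Y X.
Proof.
by apply: ev_inj => x Ux; rewrite !ev_met /metric; have [+ _] := g_inner Ux; apply.
Qed.

Lemma met_field_lin f X Y Z :
  met_field (f *: X + Y) Z = f * met_field X Z + met_field Y Z.
Proof. by rewrite /met_field !mulmxDl -!scalemxAl !mxE. Qed.

Definition half : S := const_scalar U_open 2^-1.

Definition christoffel_scalar (X Y : 'rV[S]_m) (k : 'I_m) : S :=
  half * \sum_i \sum_j X 0 i * Y 0 j *
    (partial i (gS j k) + partial j (gS i k) - partial k (gS i j)).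

(** The connection is assembled from ring operations, so that its values are
    smooth by construction; realize_nab identifies it with nabla. *)
Definition nab_field (X Y : 'rV[S]_m) : 'rV[S]_m :=
  act_mx X Y + (\row_k christoffel_scalar X Y k) *m inv_metric.

Lemma ev_const x (Ux : U x) c : ev Ux (const_scalar U_open c) = c.
Proof. by rewrite ev_as_scalar //; exact: (smooth_on_cst _ (c : R^o)). Qed.

(** Both sides are the derivative of a polynomial expression in the entries of
    g; the constant vectors u, v, w are seen as constant fields. *)
Lemma derive_bilin_const x (Ux : U x) u v w :
  'D_u (fun y => bilin (g y) v w) x =
  \sum_l \sum_i \sum_j u 0 l * v 0 i * w 0 j * ev Ux (partial l (gS i j)).
Proof.
pose c (a : 'rV[R]_m) : 'rV[S]_m := map_mx (const_scalar U_open) a.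
have cE a y : U y -> realize (c a) y = a.
  move=> Uy; apply/rowP => i; rewrite !mxE as_scalarE //.
  exact: (smooth_on_cst _ (_ : R^o)).
transitivity (ev Ux (act_scalar (c u) (met_field (c v) (c w)))).
  rewrite ev_act cE //; apply: (derive_eq_open U_open) => // y Uy.
  have := ev_met Uy (c v) (c w); rewrite /metric !cE // => <-; by [].
have evc a i : ev Ux (c a 0 i) = a 0 i.
  by have /rowP/(_ i) := cE a x Ux; rewrite mxE.
have -> : met_field (c v) (c w) = \sum_i \sum_j
    const_scalar U_open (v 0 i * w 0 j) * gS i j.
  apply: ev_inj => y Uy; rewrite ev_met /metric !cE // bilinE rmorph_sum.
  apply: eq_bigr => i _; rewrite rmorph_sum; apply: eq_bigr => j _.
  by rewrite rmorphM /= ev_metric ev_const.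
rewrite act_scalar_sum rmorph_sum exchange_big; apply: eq_bigr => i _ /=.
rewrite act_scalar_sum rmorph_sum exchange_big; apply: eq_bigr => j _ /=.
rewrite act_scalarM act_scalar_const mul0r add0r rmorphM /= ev_const rmorph_sum.
rewrite mulr_sumr; apply: eq_bigr => l _ /=; rewrite rmorphM /= evc; ring.
Qed.

Lemma sum_coord_vec (F : 'I_m -> R) k :
  \sum_j (coord_vec R k) 0 j * F j = F k.
Proof.
rewrite (bigD1 k) //= mxE !eqxx mul1r big1 ?addr0 // => j jk.
by rewrite mxE (negbTE jk) andbF mul0r.
Qed.

Lemma ev_christoffel x (Ux : U x) X Y k : ev Ux (christoffel_scalar X Y k) =
  christoffel1 g x (realize X x) (realize Y x) (coord_vec R k).
Proof.
rewrite /christoffel1 !(derive_bilin_const Ux).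
set u := realize X x; set v := realize Y x.
pose T l i j := ev Ux (partial l (gS i j)).
have -> : \sum_l \sum_i \sum_j u 0 l * v 0 i * (coord_vec R k) 0 j * T l i j
    = \sum_i \sum_j u 0 i * v 0 j * T i j k.
  apply: eq_bigr => l _; apply: eq_bigr => i _.
  by rewrite -(sum_coord_vec (T l i)) mulr_sumr; apply: eq_bigr => j _; ring.
have -> : \sum_l \sum_i \sum_j v 0 l * u 0 i * (coord_vec R k) 0 j * T l i j
    = \sum_i \sum_j u 0 i * v 0 j * T j i k.
  rewrite [RHS]exchange_big; apply: eq_bigr => l _; apply: eq_bigr => i _.
  by rewrite -(sum_coord_vec (T l i)) mulr_sumr; apply: eq_bigr => j _; ring.
have -> : \sum_l \sum_i \sum_j (coord_vec R k) 0 l * u 0 i * v 0 j * T l i j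
    = \sum_i \sum_j u 0 i * v 0 j * T k i j.
  rewrite exchange_big; apply: eq_bigr => i _; rewrite exchange_big /=.
  apply: eq_bigr => j _; rewrite -(sum_coord_vec (T ^~ i ^~ j)) mulr_sumr.
  by apply: eq_bigr => l _; ring.
rewrite /christoffel_scalar rmorphM /= ev_const rmorph_sum -big_split -sumrB.
congr (_ * _); apply: eq_bigr => i _ /=.
rewrite rmorph_sum -big_split -sumrB; apply: eq_bigr => j _ /=.
rewrite !rmorphM rmorphB rmorphD /= -/(T i j k) -/(T j i k) -/(T k i j).
by rewrite /u /v !mxE /ev; ring.
Qed.

Lemma realize_nab x (Ux : U x) X Y :
  realize (nab_field X Y) x = nabla g (realize X) (realize Y) x.
Proof.
rewrite /nab_field (realizeE _ Ux) map_mxD -!realizeE (realize_act Ux) /nabla.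
congr (_ + _); rewrite (realizeE _ Ux) map_mxM -!realizeE realize_inv_metric //.
by congr (_ *m _); apply/rowP => k; rewrite (realizeE _ Ux) !mxE /= ev_christoffel.
Qed.

Lemma nab_field_torsion X Y : nab_field X Y - nab_field Y X = flat_br X Y.
Proof.
apply: realize_inj => x Ux; rewrite /flat_br !(realizeE _ Ux) !map_mxB -!realizeE.
rewrite !realize_nab // !(realize_act Ux) -/(bracket (realize X) (realize Y) x).
exact: (nabla_torsion_free U_open g_inner).
Qed.

Lemma nab_field_metric X Y Z : act_scalar X (met_field Y Z) =
  met_field (nab_field X Y) Z + met_field Y (nab_field X Z).
Proof.
apply: ev_inj => x Ux; rewrite rmorphD /= ev_act !ev_met.
have dr (A : 'rV[S]_m) : differentiable (realize A) x.
  exact: (smooth_on_differentiable (@realize_smooth _ _ _ U_open _ _ A) Ux).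
rewrite /metric !(realize_nab Ux).
rewrite -(nabla_metric U_open g_smooth g_inner (realize X) Ux (dr Y) (dr Z)).
apply: (derive_eq_open U_open) => // y Uy; exact: (ev_met Uy).
Qed.

Lemma nab_fieldDr X Y Z : nab_field X (Y + Z) = nab_field X Y + nab_field X Z.
Proof.
rewrite /nab_field addrACA -mulmxDl.
congr (_ + _); last congr (_ *m _); apply/rowP => k.
  by rewrite !mxE act_scalarD.
rewrite !mxE /christoffel_scalar -mulrDr -big_split; congr (_ * _).
apply: eq_bigr => i _; rewrite -big_split; apply: eq_bigr => j _ /=.
by rewrite !mxE; ring.
Qed.

Lemma nab_fieldZr X f Y :
  nab_field X (f *: Y) = act_scalar X f *: Y + f *: nab_field X Y.
Proof.
rewrite /nab_field scalerDr addrA (scalemxAl f).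
congr (_ + _); last congr (_ *m _); apply/rowP => k.
  by rewrite !mxE act_scalarM.
rewrite !mxE /christoffel_scalar mulrCA; congr (_ * _); rewrite mulr_sumr.
apply: eq_bigr => i _; rewrite mulr_sumr; apply: eq_bigr => j _ /=.
by rewrite !mxE; ring.
Qed.

Lemma nab_field_lin f X Y Z :
  nab_field (f *: X + Y) Z = f *: nab_field X Z + nab_field Y Z.
Proof.
rewrite /nab_field scalerDr addrACA (scalemxAl f) -mulmxDl.
congr (_ + _); last congr (_ *m _); apply/rowP => k.
  by rewrite !mxE act_scalar_lin.
rewrite !mxE /christoffel_scalar mulrCA -mulrDr; congr (_ * _).
rewrite mulr_sumr -big_split; apply: eq_bigr => i _ /=.
rewrite mulr_sumr -big_split; apply: eq_bigr => j _ /=.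
by rewrite !mxE; ring.
Qed.

Definition frame_field (i : 'I_m) : 'rV[S]_m := delta_mx 0 i.
Definition coframe_field (i : 'I_m) : 'rV[S]_m := row i inv_metric.

Lemma met_coframe v i : met_field v (coframe_field i) = v 0 i.
Proof.
rewrite /met_field /coframe_field tr_row inv_metric_tr colE mulmxA.
by rewrite -(mulmxA v) mul_inv_metric mulmx1 -colE mxE.
Qed.

Fact nab_field_bracket X Y f : act_scalar (nab_field X Y - nab_field Y X) f =
  act_scalar X (act_scalar Y f) - act_scalar Y (act_scalar X f).
Proof. by rewrite nab_field_torsion act_flat_br. Qed.

Fact nab_field_jacobi X Y Z :
  let br A B := nab_field A B - nab_field B A in
  br X (br Y Z) + br Y (br Z X) + br Z (br X Y) = 0.
Proof.
move=> br; have E A B : br A B = flat_br A B by exact: nab_field_torsion.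
rewrite !E; exact: flat_jacobi.
Qed.

Fact frame_field_expand v :
  v = \sum_i met_field v (coframe_field i) *: frame_field i.
Proof.
by rewrite {1}(row_sum_delta v); apply: eq_bigr => i _; rewrite met_coframe.
Qed.

Fact frame_field_dual i j : met_field (frame_field i) (coframe_field j) = (i == j)%:R.
Proof. by rewrite met_coframe mxE eqxx eq_sym. Qed.

Definition field_geometry : riemannian_calculus 'rV[S]_m m :=
  @RiemannianCalculus S 'rV[S]_m m (@act_scalar _ _ _ U_open) nab_field met_field
    frame_field coframe_field (@act_scalarD _ _ _ U_open)
    (@act_scalarM _ _ _ U_open) (@act_scalar_lin _ _ _ U_open)
    nab_fieldDr nab_fieldZr nab_field_lin met_fieldC met_field_lin
    nab_field_metric nab_field_bracket nab_field_jacobi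
    frame_field_expand frame_field_dual.

Local Notation G := field_geometry.

(** The fields obtained from the ring of smooth functions vanish outside U; they
    represent the given ones because a differential expression at a point of U
    only depends on the restrictions of the fields to U. *)
Lemma nabla_ext (X X' Y Y' : 'rV[R]_m -> 'rV[R]_m) x : U x ->
  X x = X' x -> (forall y, U y -> Y y = Y' y) -> nabla g X Y x = nabla g X' Y' x.
Proof.
move=> Ux XX YY; have D := derive_eq_open U_open (X' x) YY Ux.
by rewrite /nabla XX (YY x Ux) D.
Qed.

Lemma bracket_ext (X X' Y Y' : 'rV[R]_m -> 'rV[R]_m) x : U x ->
  (forall y, U y -> X y = X' y) -> (forall y, U y -> Y y = Y' y) ->
  bracket X Y x = bracket X' Y' x.
Proof.
move=> Ux XX YY; have DY := derive_eq_open U_open (X' x) YY Ux.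
have DX := derive_eq_open U_open (Y' x) XX Ux.
by rewrite /bracket (XX x Ux) (YY x Ux) DX DY.
Qed.

Lemma curvature_ext (X X' Y Y' Z Z' : 'rV[R]_m -> 'rV[R]_m) x : U x ->
  (forall y, U y -> X y = X' y) -> (forall y, U y -> Y y = Y' y) ->
  (forall y, U y -> Z y = Z' y) -> curvature g X Y Z x = curvature g X' Y' Z' x.
Proof.
move=> Ux XX YY ZZ.
have e1 := nabla_ext Ux (XX x Ux) (fun y Uy => nabla_ext Uy (YY y Uy) ZZ).
have e2 := nabla_ext Ux (YY x Ux) (fun y Uy => nabla_ext Uy (XX y Uy) ZZ).
have e3 := nabla_ext Ux (bracket_ext Ux XX YY) ZZ.
exact (f_equal2 (fun a b : 'rV[R]_m => a - b)
  (f_equal2 (fun a b : 'rV[R]_m => a - b) e1 e2) e3).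
Qed.

Lemma realize_br x (Ux : U x) X Y :
  realize (br G X Y) x = bracket (realize X) (realize Y) x.
Proof.
rewrite /br /= nab_field_torsion /flat_br (realizeE _ Ux) map_mxB -!realizeE.
by rewrite !(realize_act Ux).
Qed.

Lemma realizeB p q (A B : 'M[S]_(p, q)) x (Ux : U x) :
  realize (A - B) x = realize A x - realize B x.
Proof. by rewrite !(realizeE _ Ux) map_mxB. Qed.

Lemma realize_curv x (Ux : U x) X Y Z :
  realize (curv G X Y Z) x = curvature g (realize X) (realize Y) (realize Z) x.
Proof.
have e1 := nabla_ext Ux (erefl (realize X x)) (fun y Uy => realize_nab Uy Y Z).
have e2 := nabla_ext Ux (erefl (realize Y x)) (fun y Uy => realize_nab Uy X Z).
have e3 := nabla_ext Ux (realize_br Ux X Y) (fun y _ => erefl (realize Z y)).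
have e1' := etrans (realize_nab Ux X (nab_field Y Z)) e1.
have e2' := etrans (realize_nab Ux Y (nab_field X Z)) e2.
have e3' := etrans (realize_nab Ux (br G X Y) Z) e3.
rewrite /curv (realizeB _ _ Ux) (realizeB _ _ Ux).
exact (f_equal2 (fun a b : 'rV[R]_m => a - b)
  (f_equal2 (fun a b : 'rV[R]_m => a - b) e1' e2') e3').
Qed.

Lemma ev_ric x (Ux : U x) Y Z :
  ev Ux (ric G Y Z) = ricci g (realize Y) (realize Z) x.
Proof.
rewrite rmorph_sum; apply: eq_bigr => i _ /=.
rewrite /curv4 /= met_coframe.
transitivity (realize (curv G (frame_field i) Y Z) x 0 i).
  by rewrite [RHS]mxE.
rewrite (realize_curv Ux).
have E y : U y -> realize (frame_field i) y = @coord_field R m i y.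
  by move=> Uy; rewrite (realizeE _ Uy) map_delta_mx.
exact: (congr1 (fun v : 'rV[R]_m => v 0 i)
  (curvature_ext Ux E (fun y _ => erefl) (fun y _ => erefl))).
Qed.

Lemma ev_lie x (Ux : U x) W X Y :
  ev Ux (lie_met G W X Y) = lie_metric (realize W) g (realize X) (realize Y) x.
Proof.
have e1 : ev Ux (act_scalar W (met_field X Y))
    = apply_field (realize W) (metric g (realize X) (realize Y)) x.
  by rewrite ev_act; apply: (derive_eq_open U_open) => // y Uy; exact: (ev_met Uy).
have e2 : ev Ux (met_field (br G W X) Y)
    = metric g (bracket (realize W) (realize X)) (realize Y) x.
  by rewrite ev_met /metric (realize_br Ux).
have e3 : ev Ux (met_field X (br G W Y))
    = metric g (realize X) (bracket (realize W) (realize Y)) x.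
  by rewrite ev_met /metric (realize_br Ux).
rewrite lie_metE rmorphB rmorphB /lie_metric -e1 -e2 -e3; reflexivity.
Qed.

End LocalMetric.

(** * Kenmotsu solitons in a chart *)

Section KenmotsuChart.
Local Open Scope classical_set_scope.
Local Open Scope ring_scope.
Variables (R : realType) (n : nat).
Local Notation m := (2 * n).+1.
Variables (U : set 'rV[R]_m) (U_open : open U).
Local Notation S := (smooth_scalar U_open).
Local Notation ev := (@ev _ _ _ U_open _).
Variables (g phi : 'rV[R]_m -> 'M[R]_m) (xi V : 'rV[R]_m -> 'rV[R]_m)
  (eta : 'rV[R]_m -> 'cV[R]_m) (alpha beta : 'rV[R]_m -> R) (lambda mu : R).
Hypothesis n_gt1 : (1 < n)%N.
Hypothesis g_smooth : smooth_on U g.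
Hypothesis phi_smooth : smooth_on U phi.
Hypothesis xi_smooth : smooth_on U xi.
Hypothesis V_smooth : smooth_on U V.
Hypothesis eta_smooth : smooth_on U eta.
Hypothesis alpha_smooth : smooth_on U alpha.
Hypothesis beta_smooth : smooth_on U beta.
Hypothesis g_inner : forall x, U x -> inner_product (g x).
Hypothesis phi2 : forall x v, U x ->
  endo (phi x) (endo (phi x) v) = - v + covec (eta x) v *: xi x.
Hypothesis eta_xi : forall x, U x -> covec (eta x) (xi x) = 1.
(** in_charts, on a single chart. *)
Definition on_fields (P : ('rV[R]_m -> 'rV[R]_m) -> ('rV[R]_m -> 'rV[R]_m) ->
         'rV[R]_m -> Prop) :=
  forall X Y, smooth_on U X -> smooth_on U Y -> forall x, U x -> P X Y x.
Hypothesis g_compatible : on_fields (fun X Y x =>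
    bilin (g x) (endo (phi x) (X x)) (endo (phi x) (Y x))
    = bilin (g x) (X x) (Y x) - covec (eta x) (X x) * covec (eta x) (Y x)).
Hypothesis nabla_phi : on_fields (fun X Y x =>
    nabla_endo g phi X Y x
    = bilin (g x) (endo (phi x) (X x)) (Y x) *: xi x
      - covec (eta x) (Y x) *: endo (phi x) (X x)).
Hypothesis ricciE : on_fields (fun X Y x =>
    ricci g X Y x = alpha x * bilin (g x) (X x) (Y x)
          + beta x * (covec (eta x) (X x) * covec (eta x) (Y x))).
Hypothesis soliton : on_fields (fun X Y x =>
    2^-1 * lie_metric V g X Y x + ricci g X Y x
      + lambda * bilin (g x) (X x) (Y x)
      + mu * (covec (eta x) (X x) * covec (eta x) (Y x)) = 0).

Let G : riemannian_calculus 'rV[S]_m m := field_geometry U_open g_smooth g_inner.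
Let phiS (v : 'rV[S]_m) : 'rV[S]_m := v *m lift_mx U_open phi.
Let xiS : 'rV[S]_m := lift_mx U_open xi.
Let VS : 'rV[S]_m := lift_mx U_open V.
Let etaS (v : 'rV[S]_m) : S := (v *m lift_mx U_open eta) 0 0.

Let realizeM p q r (A : 'M[S]_(p, q)) (B : 'M[S]_(q, r)) x (Ux : U x) :
  realize (A *m B) x = realize A x *m realize B x.
Proof. by rewrite !(realizeE _ Ux) map_mxM. Qed.

Let realize_phi v x (Ux : U x) : realize (phiS v) x = endo (phi x) (realize v x).
Proof. by rewrite (realizeM _ _ Ux) realize_lift. Qed.

Let ev_eta v x (Ux : U x) : ev Ux (etaS v) = covec (eta x) (realize v x).
Proof.
have := realizeM v (lift_mx U_open eta) Ux.
by rewrite (realize_lift U_open eta_smooth Ux) /covec => <-; rewrite mxE.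
Qed.

Let realize_xi x (Ux : U x) : realize xiS x = xi x.
Proof. exact: realize_lift. Qed.

Let ev_metG u v x (Ux : U x) :
  ev Ux (met G u v) = bilin (g x) (realize u x) (realize v x).
Proof. exact: ev_met. Qed.

Let realizeZD f (u v : 'rV[S]_m) x (Ux : U x) :
  realize (f *: u + v) x = ev Ux f *: realize u x + realize v x.
Proof. by rewrite !(realizeE _ Ux) map_mxD map_mxZ. Qed.

Let realizeZ f (u : 'rV[S]_m) x (Ux : U x) :
  realize (f *: u) x = ev Ux f *: realize u x.
Proof. by rewrite !(realizeE _ Ux) map_mxZ. Qed.

Let realizeN (u : 'rV[S]_m) x (Ux : U x) : realize (- u) x = - realize u x.
Proof. by rewrite !(realizeE _ Ux) map_mxN. Qed.

Let realize_sm (u : 'rV[S]_m) : smooth_on U (realize u).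
Proof. exact: realize_smooth. Qed.

Let phiS_lin f u v : phiS (f *: u + v) = f *: phiS u + phiS v.
Proof. by rewrite /phiS mulmxDl scalemxAl. Qed.

Let etaS_lin f u v : etaS (f *: u + v) = f * etaS u + etaS v.
Proof. by rewrite /etaS mulmxDl -scalemxAl !mxE. Qed.

Let phiS2 u : phiS (phiS u) = - u + etaS u *: xiS.
Proof.
apply: realize_inj => x Ux; rewrite !(realize_phi _ Ux) phi2 // addrC.
by rewrite [in RHS]addrC (realizeZD _ _ _ Ux) ev_eta (realizeN _ Ux) realize_xi.
Qed.

Let etaS_xi : etaS xiS = 1.
Proof. by apply: ev_inj => x Ux; rewrite ev_eta realize_xi // eta_xi // rmorph1. Qed.

Let phiS_met u v : met G (phiS u) (phiS v) = met G u v - etaS u * etaS v.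
Proof.
apply: ev_inj => x Ux; rewrite rmorphB rmorphM /= !ev_metG !(realize_phi _ Ux) !ev_eta.
exact: (g_compatible (realize_sm u) (realize_sm v)).
Qed.

Let nab_phiS u v :
  nab G u (phiS v) - phiS (nab G u v) = met G (phiS u) v *: xiS - etaS v *: phiS u.
Proof.
apply: realize_inj => x Ux.
rewrite !(realizeB _ _ Ux) !(realizeZ _ _ Ux) ev_metG ev_eta !(realize_phi _ Ux).
rewrite (realize_xi Ux) -(nabla_phi (realize_sm u) (realize_sm v) Ux).
rewrite (realize_nab g_smooth g_inner Ux u (phiS v)).
rewrite (realize_nab g_smooth g_inner Ux u v).
have e := nabla_ext U_open g Ux (erefl (realize u x)) (fun y Uy => realize_phi v Uy).
exact (congr1 (fun a => a - endo (phi x) (nabla g (realize u) (realize v) x)) e).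
Qed.

Let nab_xiS u : nab G u xiS = u - met G u xiS *: xiS.
Proof.
exact: (nab_reeb (@scalar_regular _ _ _ U_open) (@scalar_reduced _ _ _ U_open)
  phiS_lin etaS_lin phiS2 etaS_xi phiS_met nab_phiS).
Qed.

Let etaS_met u : etaS u = met G u xiS.
Proof.
exact: (eta_met (@scalar_reduced _ _ _ U_open)
  phiS_lin etaS_lin phiS2 etaS_xi phiS_met).
Qed.

Let ev_eta_met u x (Ux : U x) : ev Ux (met G u xiS) = covec (eta x) (realize u x).
Proof. by rewrite -etaS_met ev_eta. Qed.

Let al : S := as_scalar U_open alpha.
Let be : S := as_scalar U_open beta.
Let la : S := const_scalar U_open lambda.
Let mus : S := const_scalar U_open mu.

Let ricS u v : ric G u v =
  al * met G u v + be * (met G u xiS * met G v xiS).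
Proof.
apply: ev_inj => x Ux; rewrite !(rmorphD, rmorphM) /= !ev_eta_met ev_metG.
rewrite !ev_as_scalar //.
rewrite -(ricciE (realize_sm u) (realize_sm v) Ux).
exact: ev_ric.
Qed.

Let solitonS u v : lie_met G VS u v
  + (ric G u v + la * met G u v + mus * (met G u xiS * met G v xiS)) *+ 2 = 0.
Proof.
apply: ev_inj => x Ux.
have VE y : U y -> realize VS y = V y by move=> Uy; exact: realize_lift.
have lieE : ev Ux (lie_met G VS u v) = lie_metric V g (realize u) (realize v) x.
  rewrite ev_lie /lie_metric /apply_field /metric (VE x Ux).
  by rewrite !(bracket_ext U_open Ux VE (fun y _ => erefl)).
have := soliton (realize_sm u) (realize_sm v) Ux.
rewrite rmorph0 rmorphD /= lieE rmorphMn !rmorphD !rmorphM /= !ev_const.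
rewrite !ev_eta_met ev_metG ev_ric.
move: (lie_metric _ _ _ _ _) (ricci _ _ _ _) => L r sol.
by rewrite -[RHS](mulr0 2) -sol; field.
Qed.

(** This is beta_eq0 over the ring of smooth functions on U, which is meant to be
    the image of a chart. *)
Lemma chart_coefficients x : U x -> beta x = 0 /\ alpha x = - (2 * n)%:R.
Proof.
have met1 : met G xiS xiS = 1 by rewrite -etaS_met.
have be0 : be = 0.
  apply: (beta_eq0 (@scalar_regular _ _ _ U_open) (@scalar_reduced _ _ _ U_open)
    met1 nab_xiS ricS n_gt1 _ _ solitonS) => u; exact: act_scalar_const.
have al0 : al = - (2 * n)%:R.
  by have := eta_einstein_sum met1 nab_xiS ricS; rewrite be0 subr0.
move=> Ux; split.
  by have := congr1 (ev Ux) be0; rewrite ev_as_scalar // rmorph0.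
by have := congr1 (ev Ux) al0; rewrite ev_as_scalar // rmorphN rmorph_nat.
Qed.

End KenmotsuChart.

Theorem theorem3p1 (R : realType) (n : nat) (M : topologicalType)
    (A : smooth_atlas R (2 * n).+1 M)
    (phi : chart A -> 'rV[R]_((2 * n).+1) -> 'M[R]_((2 * n).+1))
    (xi : chart A -> 'rV[R]_((2 * n).+1) -> 'rV[R]_((2 * n).+1))
    (eta : chart A -> 'rV[R]_((2 * n).+1) -> 'cV[R]_((2 * n).+1))
    (g : chart A -> 'rV[R]_((2 * n).+1) -> 'M[R]_((2 * n).+1))
    (V : chart A -> 'rV[R]_((2 * n).+1) -> 'rV[R]_((2 * n).+1))
    (n_gt1 : (1 < n)%N)
    (M_manifold : manifold M)
    (M_kenmotsu : kenmotsu phi xi eta g)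
    (M_eta_einstein : eta_einstein eta g)
    (V_field : vector_field V)
    (V_soliton : eta_ricci_soliton eta g V) :
  einstein g /\
  (forall (a : chart A) (x : 'rV[R]_((2 * n).+1)), img a x ->
     scalar_curvature (g a) x = - (2 * n * (2 * n + 1))%N%:R).
Proof.
have [[[[phi_smooth _] [xi_smooth _] [eta_smooth _] phi2 eta_xi]
  [[g_smooth _] g_inner] compat] nabla_phi] := M_kenmotsu.
have [alpha [beta [alpha_smooth beta_smooth ricE]]] := M_eta_einstein.
have [V_smooth _] := V_field.
have [lambda [mu sol]] := V_soliton.
have coef (a : chart A) x (Ux : img a x) :
    beta (Defs.point a x) = 0 /\ alpha (Defs.point a x) = - (2 * n)%:R.
  exact: (@chart_coefficients R n (img a) (@img_open _ _ _ A a)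
    (g a) (phi a) (xi a) (V a) (eta a)
    (alpha \o Defs.point a) (beta \o Defs.point a) lambda mu n_gt1
    (g_smooth a) (phi_smooth a) (xi_smooth a) (V_smooth a) (eta_smooth a)
    (alpha_smooth a) (beta_smooth a) (g_inner a) (phi2 a) (eta_xi a)
    (compat a) (nabla_phi a) (ricE a) (sol a) x Ux).
have einstein_g : in_charts (fun a X Y x =>
    ricci (g a) X Y x = - (2 * n)%:R * bilin (g a x) (X x) (Y x)).
  move=> a X Y sX sY x Ux; rewrite (ricE a X Y sX sY x Ux).
  by have [-> ->] := coef a x Ux; rewrite mul0r addr0.
split; first by exists (- (2 * n)%:R); exact: einstein_g.
move=> a x Ux; have gu := inner_product_unitmx (g_inner a x Ux).
have gT := inner_product_tr (g_inner a x Ux).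
rewrite /scalar_curvature.
transitivity (- (2 * n)%:R * \tr (invmx (g a x) *m g a x)).
  rewrite /mxtrace mulr_sumr; apply: eq_bigr => i _.
  rewrite mxE mulr_sumr; apply: eq_bigr => j _.
  have sc k : smooth_on (img a) (@coord_field R (2 * n).+1 k).
    exact: (smooth_on_cst (@img_open _ _ _ A a) (coord_vec R k)).
  rewrite (einstein_g a _ _ (sc i) (sc j) x Ux).
  have gji : g a x j i = g a x i j by rewrite -[in LHS]gT mxE.
  by rewrite /coord_field /coord_vec bilin_delta gji mulrCA.
by rewrite mulVmx // mxtrace1 mulNr -natrM addn1.
Qed.
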